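(* Let $N$ be a positive integer, let $h$ be the largest positive integer such that $h^2|N$ and $h|24$, and set $n=N/h$. Let $S$ be a subgroup of $\mathrm{Ex}(n/h)$, and set $\Gamma=\Gamma_0(n\|h)+S$. Then the quotient $\Gamma\backslash\mathbb H$ is in natural correspondence with $n\|h+S$-equivalence classes of solid tori (the correspondence being induced by $z\mapsto(E_z,C_z)$, $z\in\mathbb H$).
   Context: Exact divisors. $\mathrm{Ex}(n)$ is the set of positive divisors $e$ of $n$ with $(e,n/e)=1$, a group under $(e,f)\mapsto ef/(e,f)^2$. If $m|n$ there is a natural injection $\mathrm{Ex}(m)\to\mathrm{Ex}(n)$ sending $e$ to the exact divisor of $n$ having the same prime divisors as $e$. Groups. $[\begin{smallmatrix} a & b \\ c & d \end{smallmatrix}]$ denotes the image in $PSL_2(\mathbb R)$ of a matrix of positive determinant (rescaled to determinant 1); in a display of the form $[\begin{smallmatrix} ae & b \\ c & de \end{smallmatrix}]$ the stated determinant condition is as given. For $h|n$ and $S<\mathrm{Ex}(n/h)$, $$\Gamma_0(n|h)+S=\Big\{\begin{bmatrix} ae & b/h \\ cn & de \end{bmatrix}: a,b,c,d\in\mathbb Z,\ e\in S,\ ade-bcn/(eh)=1\Big\}.$$ Assume $h|24$; then this group contains and normalizes $\Gamma_0(nh)$. It is of Fricke type if it contains $[\begin{smallmatrix} 0 & -1 \\ nh & 0 \end{smallmatrix}]$. Let $S'$ be the image of $S$ under $\mathrm{Ex}(n/h)\to\mathrm{Ex}(nh)$, and put $$x=\begin{bmatrix} 1 & 1/h \\ 0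 & 1 \end{bmatrix},\quad y=\begin{bmatrix} 1 & 0 \\ n & 1 \end{bmatrix},\quad w_{e'}=\begin{bmatrix} ae' & b \\ cnh & de' \end{bmatrix}\ (e'\in S'),$$ with any integers $a,b,c,d$ such that $ade'-bcnh/e'=1$. The cosets of $x,y,w_{e'}$ generate $(\Gamma_0(n|h)+S)/\Gamma_0(nh)$. Let $\lambda:(\Gamma_0(n|h)+S)/\Gamma_0(nh)\to\mathbb Z/h$ be the homomorphism determined by $\lambda(x)=1$, $\lambda(w_{e'})=0$ for all $e'\in S'$, and $\lambda(y)=-1$ if $\Gamma_0(n|h)+S$ is of Fricke type, $\lambda(y)=1$ if not (it is part of the setting that this is well defined). $\Gamma_0(n\|h)+S$ is the kernel of the composition $\Gamma_0(n|h)+S\to(\Gamma_0(n|h)+S)/\Gamma_0(nh)\xrightarrow{\lambda}\mathbb Z/h$. Solid tori. A solid torus is a pair $(E,C)$ with $E$ an elliptic curve over $\mathbb C$ and $C$ an oriented subgroup of $E$ isomorphic to $S^1$. An isomorphism of solid tori is an isomorphism of elliptic curves restricting to an orientation preserving isomorphism of the subgroups. For $z\in\mathbb H$ let $E_z=\mathbb C/(\mathbb Zz+\mathbb Z)$ and let $C_z$ be the image of $\mathbb R$ in $E_z$; this depends only on $z$ modulo $\mathbb Z$, and every solid torus is isomorphic to some $(E_z,C_z)$. Put $C[n]=C\cap E[n]$, where $E[n]$ is the group of $n$-division points. $(E,C)/C[n]$ is the solid torus consisting of $E/C[n]$ and the image of $C$; there are canonical maps $(E,C)\to(E,C)/C[n]$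 (projection) and $(E,C)/C[n]\to(E,C)$ (induced by $E/C[n]\to E/E[n]\cong E$). An $n$-compatible isogeny $(E',C')\to(E,C)$ is an isogeny $E'\to E$ mapping $C'[n]$ into $C[n]$; it is an $n$-compatible isomorphism if it is an isomorphism $E'\to E$ inducing an isomorphism $C'[n]\to C[n]$. For $e\in\mathrm{Ex}(n)$, $(E,C)$ and $(E',C')$ are $n+e$-related if there is an $n$-compatible isogeny $(E',C')\to(E,C)$ that factors through the canonical maps $(E',C')\to(E',C')/C'[e]$ and $(E,C)/C[e]\to(E,C)$, inducing $n/e$-compatible isomorphisms $(E',C')/C'[e]\to(E,C)$ and $(E',C')\to(E,C)/C[e]$. For $h|n$ and $S<\mathrm{Ex}(n/h)$, $(E,C)$ and $(E',C')$ are $n|h+S$-equivalent if $(E,C)/C[h]$ and $(E',C')/C'[h]$ are $n/h+e$-related for some $e\in S$. $n\|h+S$-equivalence. Let $N=nh$ with $h$ as in the claim. Let $(E,C)\cong(E_z,C_z)$ and $(E',C')\cong(E_{z'},C_{z'})$ be $n|h+S$-equivalent. Then $z'=\gamma_k\cdots\gamma_1\gamma_0 z$ for some sequence with $\gamma_0\in\Gamma_0(N)$ and $\gamma_i\in\{x,y,w_{e'}\mid e'\in S'\}$ for $1\le i\le k$. The solid tori are $n\|h+S$-equivalent if there is such a sequence with $\sum_{i=1}^k\lambda(\gamma_i)=0$ in $\mathbb Z/h$. *)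

(* Defs.v *)
From HB Require Import structures.
From mathcomp Require Import all_boot all_order all_algebra.
From mathcomp Require Import ring_quotient generic_quotient.
From mathcomp Require Import all_classical all_reals all_analysis.
From mathcomp Require Import complex.

Set Implicit Arguments.
Unset Strict Implicit.
Unset Printing Implicit Defensive.

Import Order.TTheory GRing.Theory Num.Theory numFieldNormedType.Exports.

Local Open Scope classical_set_scope.
Local Open Scope ring_scope.
Local Open Scope complex_scope.
Local Open Scope quotient_scope.

Definition exact_div (n e : nat) : Prop := (e %| n)%N /\ coprime e (n %/ e).

(* Every element of Ex(n) is its own inverse, so closure under inverses is
   automatic. *)
Definition Ex_subgroup (n : nat) (S : set nat) : Prop :=
  [/\ S `<=` exact_div n, S 1%N
    & forall e f, S e -> S f -> S ((e * f) %/ gcdn e f ^ 2)%N].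

(* The image of S under the injection Ex(m) -> Ex(n), for m dividing n. *)
Definition Ex_image (n : nat) (S : set nat) : set nat :=
  [set e' | exact_div n e' /\ exists2 e, S e & primes e' = primes e].

Definition classes_of (T : Type) (r : T -> T -> Prop) : Type :=
  {A : set T | exists x, A = [set y | r x y]}.

Definition class_of (T : Type) (r : T -> T -> Prop) (x : T) : classes_of r :=
  exist _ [set y | r x y] (ex_intro _ x erefl).

(* R[i] with its numClosedFieldType structure exposed, so that the library's
   topology and norm on numeric fields apply to it. *)
Definition CC (R : realType) : numClosedFieldType := R[i].

Section Groups.
Variable R : realType.
Implicit Types (A B : 'M[R]_2) (n h N : nat) (S : set nat).

Definition uhp : Type := {z : CC R | 0 < complex.Im z}.

Definition mx2 (a b c d : R) : 'M[R]_2 :=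
  \matrix_(i, j) if i == 0 then (if j == 0 then a else b)
                 else (if j == 0 then c else d).

Definition moebius A (z : CC R) : CC R :=
  ((A 0 0)%:C * z + (A 0 1)%:C) / ((A 1 0)%:C * z + (A 1 1)%:C).

(* Subsets of PSL_2(R) = GL_2^+(R) / R^* are represented by their preimages in
   GL_2^+(R), i.e. by sets of real matrices of positive determinant that are
   stable under nonzero scalars; k below is the scalar. Gamma0_bar n h S stands
   for Gamma_0(n|h)+S and Gamma0_dbar n h S lam for Gamma_0(n||h)+S. *)
Definition Gamma0 N : set 'M[R]_2 :=
  [set A | exists (a b c d : int) (k : R),
    [/\ k != 0, a * d - b * c * N%:Z = 1
      & A = k *: mx2 a%:~R b%:~R (c%:~R * N%:R) d%:~R]].

(* The division n %/ (e * h) is exact, since e divides n / h. *)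
Definition Gamma0_bar n h S : set 'M[R]_2 :=
  [set A | exists (a b c d : int) (e : nat) (k : R),
    [/\ S e, k != 0, a * d * e%:Z - b * c * (n %/ (e * h))%N%:Z = 1
      & A = k *: mx2 (a%:~R * e%:R) (b%:~R / h%:R)
                     (c%:~R * n%:R) (d%:~R * e%:R)]].

Definition Fricke_type n h S : Prop :=
  Gamma0_bar n h S (mx2 0 (-1) (n * h)%:R 0).

Definition mx_x h : 'M[R]_2 := mx2 1 h%:R^-1 0 1.

Definition mx_y n : 'M[R]_2 := mx2 1 0 n%:R 1.

(* All the matrices w_e', for all e' in S' and all admissible a, b, c, d. *)
Definition mx_w n h S : set 'M[R]_2 :=
  [set A | exists (a b c d : int) (e' : nat),
    [/\ Ex_image (n * h) S e',
        a * d * e'%:Z - b * c * ((n * h) %/ e')%N%:Z = 1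
      & A = mx2 (a%:~R * e'%:R) b%:~R
                (c%:~R * (n * h)%:R) (d%:~R * e'%:R)]].

(* lam induces the homomorphism lambda : (Gamma_0(n|h)+S)/Gamma_0(nh) -> Z/h;
   values in Z/h are represented by integers, to be compared modulo h. Only the
   values of lam on Gamma_0(n|h)+S are relevant. *)
Definition is_lambda n h S (lam : 'M[R]_2 -> int) : Prop :=
  [/\ forall A B, Gamma0_bar n h S A -> Gamma0_bar n h S B ->
        (lam (A *m B) = lam A + lam B %[mod h%:Z])%Z,
      forall A, Gamma0 (n * h) A -> (lam A = 0 %[mod h%:Z])%Z,
      (lam (mx_x h) = 1 %[mod h%:Z])%Z,
      forall A, mx_w n h S A -> (lam A = 0 %[mod h%:Z])%Z
    & (lam (mx_y n) = if `[< Fricke_type n h S >] then -1 else 1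
         %[mod h%:Z])%Z].

Definition Gamma0_dbar n h S (lam : 'M[R]_2 -> int) : set 'M[R]_2 :=
  [set A | Gamma0_bar n h S A /\ (lam A = 0 %[mod h%:Z])%Z].

Definition orbit_rel (G : set 'M[R]_2) (z z' : uhp) : Prop :=
  exists2 A, G A & val z' = moebius A (val z).

End Groups.

(* An elliptic curve over C is a complex torus C/L, L being a lattice, i.e. a
   discrete subgroup of C that spans C over R. *)
Record ellCurve (R : realType) := EllCurve {
  lattice_pred : CC R -> bool;
  lattice_closed : zmod_closed lattice_pred;
  lattice_discrete : exists2 eps : CC R, 0 < eps &
    forall z, z \in lattice_pred -> `|z| < eps -> z = 0;
  lattice_span : exists w1 w2 : CC R,
    [/\ w1 \in lattice_pred, w2 \in lattice_pred
      & forall z, exists a b : R, z = a%:C * w1 + b%:C * w2] }.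

Definition lattice (R : realType) (E : ellCurve R) : zmodClosed (CC R) :=
  HB.pack_for (zmodClosed (CC R)) (lattice_pred E : {pred CC R})
    (GRing.isZmodClosed.Build (CC R) (lattice_pred E) (lattice_closed E)).

Definition pts (R : realType) (E : ellCurve R) : zmodType :=
  {ideal_quot (lattice E)}.

Definition pr (R : realType) (E : ellCurve R) (z : CC R) : pts E :=
  \pi_{ideal_quot (lattice E)} z.

Definition lift (R : realType) (E : ellCurve R) (p : pts E) : CC R :=
  repr (p : {ideal_quot (lattice E)}).

Definition tpts (R : realType) (E : ellCurve R) : topologicalType :=
  quotient_topology {ideal_quot (lattice E)}.

Section EllipticCurves.
Variable R : realType.
Implicit Types E : ellCurve R.

Lemma prE E z z' : (pr E z == pr E z') = (z - z' \in lattice E).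
Proof. by rewrite /pr -Quotient.idealrBE. Qed.

Lemma pr_eq0 E z : (pr E z == 0) = (z \in lattice E).
Proof.
by rewrite -[z in RHS]subr0 -prE /pr raddf0.
Qed.

Lemma liftK E p : pr E (lift p) = p.
Proof. exact: reprK. Qed.

Lemma lift_pr E z : lift (pr E z) - z \in lattice E.
Proof. by rewrite -prE liftK. Qed.

Lemma prB E z z' : pr E (z - z') = pr E z - pr E z'.
Proof. by rewrite /pr raddfB. Qed.

Lemma prMn E z n : pr E (z *+ n) = pr E z *+ n.
Proof. by rewrite /pr raddfMn. Qed.

(* f is holomorphic: it lifts, near every point, to a holomorphic function. *)
Definition holomorphic_map E' E (f : pts E' -> pts E) : Prop :=
  forall z0 : CC R, exists g : CC R -> CC R,
    (\forall z \near z0, derivable g z 1) /\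
    (\forall z \near z0, f (pr E' z) = pr E (g z)).

Definition isogeny E' E (f : pts E' -> pts E) : Prop :=
  [/\ zmod_morphism f, holomorphic_map f & exists p, f p != 0].

Definition ell_iso E' E (f : pts E' -> pts E) : Prop :=
  isogeny f /\ exists g : pts E -> pts E',
    [/\ isogeny g, cancel f g & cancel g f].

End EllipticCurves.

(* C is the range of circ, which is an isomorphism from R/Z (with its standard
   orientation) to the oriented group C. As the only automorphisms of the
   topological group R/Z are 1 and -1, circ carries exactly the same
   information as C together with its orientation. *)
Record solidTorus (R : realType) := SolidTorus {
  curve : ellCurve R;
  circ : R -> pts curve;
  circ_morph : zmod_morphism circ;
  circ_cont : continuous (circ : R -> tpts curve);
  circ_ker : forall t, circ t = 0 <-> t \is a Num.int }.

Arguments circ {R} T t : rename.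

Section SolidTori.
Variable R : realType.
Implicit Types (T : solidTorus R) (n e : nat).

Definition circle T : set (pts (curve T)) := range (circ T).

Arguments circle : clear implicits.

Definition preserves_orientation T' T
    (f : pts (curve T') -> pts (curve T)) : Prop :=
  exists2 r : R -> R, {homo r : s t / s < t}
                    & forall t, f (circ T' t) = circ T (r t).

Definition torus_iso T' T : Prop :=
  exists f : pts (curve T') -> pts (curve T),
    [/\ ell_iso f, f @` circle T' = circle T & preserves_orientation f].

Definition div_circle T n : set (pts (curve T)) :=
  [set p | circle T p /\ p *+ n = 0].

Arguments div_circle : clear implicits.

Definition compat_isogeny n T' T (f : pts (curve T') -> pts (curve T)) : Prop :=
  isogeny f /\ f @` div_circle T' n `<=` div_circle T n.

Definition compat_iso n T' T (f : pts (curve T') -> pts (curve T)) : Prop :=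
  ell_iso f /\ f @` div_circle T' n = div_circle T n.

(* The quotient (E, C)/C[n] of a solid torus, for n > 0: the curve E/C[n] is
   C/L', where L' is the preimage of C[n] in C. As C[0] = C, the quotient for
   n = 0 is set to be the one for n = 1. *)

Section Quotient.
Variables (T : solidTorus R) (n0 : nat).
Let n := maxn n0 1.

Let n_gt0 : (0 < n)%N. Proof. by rewrite /n leq_max orbT. Qed.

Let circ0 : circ T 0 = 0.
Proof. by rewrite -[0 in LHS](subrr 0) circ_morph subrr. Qed.

Let circN t : circ T (- t) = - circ T t.
Proof. by rewrite -[- t]sub0r circ_morph circ0 sub0r. Qed.

Let circD s t : circ T (s + t) = circ T s + circ T t.
Proof. by rewrite -[t]opprK circ_morph !circN !opprK. Qed.

Let circMn t k : circ T (t *+ k) = circ T t *+ k.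
Proof. by elim: k => [|k IH]; rewrite ?mulr0n ?circ0// !mulrS circD IH. Qed.

Definition quot_pred : CC R -> bool :=
  fun z => `[< div_circle T n (pr (curve T) z) >].

Lemma quot_predP : zmod_closed quot_pred.
Proof.
split => [|z z'].
  apply/asboolP; have -> : pr (curve T) 0 = 0 by rewrite /pr raddf0.
  by split; [exists 0|rewrite mul0rn].
move=> /asboolP[[s _ sE] zn] /asboolP[[s' _ s'E] z'n]; apply/asboolP.
split; first by exists (s - s') => //; rewrite prB circ_morph sE s'E.
by rewrite prB mulrnBl zn z'n subrr.
Qed.

Let sub_quot z : z \in lattice (curve T) -> quot_pred z.
Proof.
rewrite -pr_eq0 => /eqP z0; apply/asboolP; rewrite z0.
by split; [exists 0|rewrite mul0rn].
Qed.

Lemma quot_discrete : exists2 eps : CC R, 0 < eps &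
  forall z, z \in quot_pred -> `|z| < eps -> z = 0.
Proof.
have [eps eps0 H] := lattice_discrete (curve T).
have n0' : (0 : CC R) < n%:R by rewrite ltr0n.
exists (eps / n%:R); first by rewrite divr_gt0.
move=> z /asboolP[_]; rewrite -prMn => /eqP; rewrite pr_eq0 => zL.
rewrite ltr_pdivlMr// => zlt.
have := H _ zL; rewrite normrMn -mulr_natr => /(_ zlt)/eqP.
by rewrite mulrn_eq0 -leqn0 leqNgt n_gt0 /= => /eqP.
Qed.

Lemma quot_span : exists w1 w2 : CC R,
  [/\ w1 \in quot_pred,
      w2 \in quot_pred
    & forall z, exists a b : R, z = a%:C * w1 + b%:C * w2].
Proof.
have [w1 [w2 [w1L w2L H]]] := lattice_span (curve T).
by exists w1, w2; split => //; exact: sub_quot.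
Qed.

Definition quot_curve : ellCurve R := EllCurve quot_predP quot_discrete quot_span.

Definition quot_proj (p : pts (curve T)) : pts quot_curve :=
  pr quot_curve (lift p).

Lemma quot_projE z : quot_proj (pr (curve T) z) = pr quot_curve z.
Proof. by apply/eqP; rewrite prE; exact/sub_quot/lift_pr. Qed.

Lemma quot_proj_morph : zmod_morphism quot_proj.
Proof.
by move=> p q; rewrite -(liftK p) -(liftK q) -prB !quot_projE prB.
Qed.

Lemma quot_proj_eq0 p : quot_proj p = 0 <-> div_circle T n p.
Proof.
rewrite -{2}(liftK p); split => [/eqP|H].
  by rewrite pr_eq0 => /asboolP.
by apply/eqP; rewrite pr_eq0; exact/asboolP.
Qed.

(* The image of C in E/C[n] is parametrized by t |-> circ (t / n) mod C[n]. *)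
Definition quot_circ (t : R) : pts quot_curve := quot_proj (circ T (t / n%:R)).

Lemma quot_circ_morph : zmod_morphism quot_circ.
Proof.
by move=> s t; rewrite /quot_circ mulrBl circ_morph quot_proj_morph.
Qed.

Lemma quot_circ_cont : continuous (quot_circ : R -> tpts quot_curve).
Proof.
have proj_cont :
    continuous (quot_proj : tpts (curve T) -> tpts quot_curve).
  apply/quotient_continuous.
  have -> : (quot_proj : tpts (curve T) -> tpts quot_curve) \o
      \pi_(quotient_topology {ideal_quot (lattice (curve T))}) =
      \pi_(quotient_topology {ideal_quot (lattice quot_curve)}).
    by apply/funext => z; exact: quot_projE.
  exact: pi_continuous.
move=> t; apply: (@continuous_comp R (tpts (curve T)) (tpts quot_curve)
  (fun t : R => circ T (t / n%:R)) quot_proj); last exact: proj_cont.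
apply: (@continuous_comp R R (tpts (curve T)) (fun t : R => t / n%:R) (circ T)).
  exact: mulrr_continuous.
exact: circ_cont.
Qed.

Lemma quot_circ_ker t : quot_circ t = 0 <-> t \is a Num.int.
Proof.
have tn : (t / n%:R) *+ n = t.
  by rewrite -[LHS]mulr_natr divfK// pnatr_eq0 -lt0n.
rewrite quot_proj_eq0; split => [[_]|tZ].
  by rewrite -circMn tn => /circ_ker.
by split; [exists (t / n%:R) | rewrite -circMn tn; exact/circ_ker].
Qed.

Definition quot_torus : solidTorus R :=
  SolidTorus quot_circ_morph quot_circ_cont quot_circ_ker.

(* The canonical map E/C[n] -> E/E[n] = E, where E/E[n] is identified with E
   through multiplication by n. *)
Definition quot_back (p : pts quot_curve) : pts (curve T) :=
  pr (curve T) (lift p *+ n).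

Lemma quot_backE p : quot_back (quot_proj p) = p *+ n.
Proof.
rewrite -[in RHS](liftK p) /quot_back /quot_proj -prMn.
apply/eqP; rewrite prE -mulrnBl -pr_eq0 prMn.
by have /asboolP[_ ->] := lift_pr quot_curve (lift p).
Qed.

End Quotient.

(* (E, C) = T and (E', C') = T' are n+e-related, for e in Ex(n). *)
Definition related n e T T' : Prop :=
  exists (f : pts (curve T') -> pts (curve T))
         (g : pts (curve (quot_torus T' e)) -> pts (curve T))
         (k : pts (curve T') -> pts (curve (quot_torus T e))),
    [/\ compat_isogeny n f,
        f = g \o @quot_proj T' e,
        f = @quot_back T e \o k,
        @compat_iso (n %/ e) (quot_torus T' e) T g
      & @compat_iso (n %/ e) T' (quot_torus T e) k].

(* n|h+S-equivalence; for its refinement, n||h+S-equivalence, see dbar_equiv. *)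
Definition bar_equiv n h (S : set nat) T T' : Prop :=
  exists2 e, S e & related (n %/ h) e (quot_torus T h) (quot_torus T' h).

Section StandardTorus.
Variable z : uhp R.
Let zi : R := complex.Im (val z).
Let zi_gt0 : 0 < zi. Proof. exact: (valP z). Qed.

Definition std_pred : CC R -> bool :=
  fun u => `[< exists a b : int, u = a%:~R * val z + b%:~R >].

Lemma std_predP : zmod_closed std_pred.
Proof.
split; first by apply/asboolP; exists 0, 0; rewrite mul0r addr0.
move=> _ _ /asboolP[a [b ->]] /asboolP[c [d ->]]; apply/asboolP.
by exists (a - c), (b - d); rewrite !intrB mulrBl opprD addrACA.
Qed.

Let stdE (a b : R) : a%:C * val z + b%:C =
  (a * complex.Re (val z) + b) +i* (a * zi) :> R[i].
Proof.
rewrite /zi; case: (val z) => x y /=.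
by congr Complex; rewrite /= ?mul0r ?subr0 ?addr0.
Qed.

Let rcM_int (m : int) : (m%:~R : CC R) = (m%:~R : R)%:C.
Proof. by rewrite rmorph_int. Qed.

Lemma std_discrete : exists2 eps : CC R, 0 < eps &
  forall u, u \in std_pred -> `|u| < eps -> u = 0.
Proof.
have m0 : 0 < Num.min 1 zi by rewrite lt_min ltr01.
exists (Num.min 1 zi)%:C; first by rewrite (ltcR 0).
move=> u /asboolP[a [b ->]]; rewrite !rcM_int stdE => ltm.
move: ltm; rewrite normc_def ltcR /= => ltm.
have ltIm : `|a%:~R * zi| < Num.min 1 zi.
  by apply: le_lt_trans ltm; rewrite -sqrtr_sqr ler_wsqrtr// lerDr sqr_ge0.
have ltRe : `|a%:~R * complex.Re (val z) + b%:~R| < Num.min 1 zi.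
  by apply: le_lt_trans ltm; rewrite -sqrtr_sqr ler_wsqrtr// lerDl sqr_ge0.
have a0 : a = 0.
  apply: contraTeq ltIm => an0; rewrite -leNgt ge_min; apply/orP; right.
  rewrite normrM (gtr0_norm zi_gt0) ler_peMl ?(ltW zi_gt0)//.
  by rewrite -intr_norm ler1z -gtz0_ge1 normr_gt0.
have b0 : b = 0.
  move: ltRe; rewrite a0 mul0r add0r; apply: contraTeq => bn0.
  rewrite -leNgt ge_min; apply/orP; left.
  by rewrite -intr_norm ler1z -gtz0_ge1 normr_gt0.
by rewrite a0 b0 !mul0r addr0.
Qed.

Lemma std_span : exists w1 w2 : CC R,
  [/\ w1 \in std_pred,
      w2 \in std_pred
    & forall u, exists a b : R, u = a%:C * w1 + b%:C * w2].
Proof.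
exists (val z), 1; split.
- by apply/asboolP; exists 1, 0; rewrite mul1r addr0.
- by apply/asboolP; exists 0, 1; rewrite mul0r add0r.
move=> u; exists (complex.Im u / zi),
  (complex.Re u - complex.Im u / zi * complex.Re (val z)).
rewrite mulr1 stdE divfK ?gt_eqF// [_ * _ + _]addrC subrK.
by case: u.
Qed.

Definition std_curve : ellCurve R := EllCurve std_predP std_discrete std_span.

Definition std_circ (t : R) : pts std_curve := pr std_curve t%:C.

Lemma std_circ_morph : zmod_morphism std_circ.
Proof. by move=> s t; rewrite /std_circ rmorphB prB. Qed.

Lemma std_circ_cont : continuous (std_circ : R -> tpts std_curve).
Proof.
have rc_cont : continuous (fun t : R => t%:C : CC R).
  move=> t; apply/cvgrPdist_lt => e e0.
  have [e' e'E] : exists e' : R, e = e'%:C.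
    exists (complex.Re e); move: e0; case: (e) => x y.
    by rewrite ltcE /= => /andP[/eqP-> _].
  move: e0; rewrite e'E (ltcR 0) => e'0; near=> s.
  rewrite -rmorphB normc_def /= expr0n /= addr0 sqrtr_sqr ltcR.
  by near: s; exact: (@cvgr_dist_lt _ R^o).
move=> t; apply: (@continuous_comp R (CC R) (tpts std_curve)
  (fun t : R => t%:C : CC R) (pr std_curve)); first exact: rc_cont.
exact: pi_continuous.
Unshelve. all: by end_near.
Qed.

Lemma std_circ_ker t : std_circ t = 0 <-> t \is a Num.int.
Proof.
split=> [/eqP|/intrP[m ->]]; last first.
  apply/eqP; rewrite pr_eq0; apply/asboolP; exists 0, m.
  by rewrite mul0r add0r rcM_int.
rewrite pr_eq0 => /asboolP[a [b]]; rewrite !rcM_int stdE => -[-> /esym/eqP].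
rewrite mulf_eq0 (gt_eqF zi_gt0) orbF => /eqP ->.
by rewrite mul0r add0r intr_int.
Qed.

(* The solid torus (E_z, C_z); the orientation is that of the real line. *)
Definition std_torus : solidTorus R :=
  SolidTorus std_circ_morph std_circ_cont std_circ_ker.

End StandardTorus.

(* n||h+S-equivalence; z and z' range over all the upper half-plane points
   with (E, C) = (E_z, C_z) and (E', C') = (E_z', C_z') up to isomorphism, and
   gs lists gamma_k, ..., gamma_1 in this order. *)
Definition dbar_equiv n h (S : set nat) (lam : 'M[R]_2 -> int) T T' : Prop :=
  bar_equiv n h S T T' /\
  exists (z z' : uhp R) (g0 : 'M[R]_2) (gs : seq 'M[R]_2),
    [/\ torus_iso T (std_torus z) /\ torus_iso T' (std_torus z'),
        Gamma0 (n * h) g0,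
        forall g, g \in gs -> g = mx_x R h \/ g = mx_y R n \/ mx_w n h S g,
        val z' = foldr (@moebius R) (moebius g0 (val z)) gs
      & ((\sum_(g <- gs) lam g)%R = 0 %[mod h%:Z])%Z].

End SolidTori.

(* Main.v *)
(** A matrix A of Gamma_0(n|h)+S acts on H, after z |-> h z, as multiplication
    by a complex number between the lattices of the quotients by C[h], and this
    multiplication is the isogeny required by n|h+S-equivalence. The group is
    generated by x, y, the w_e' and Gamma_0(nh), and lambda is a homomorphism, so
    the sum of the lambda(gamma_i) does not depend on the chosen word: n||h+S-
    equivalence of E_z and E_z' means that z' = A z for some A in the kernel of
    lambda. Moreover every solid torus is isomorphic to (E_z, C_z) for a z in H
    that is unique modulo Z: C lifts to a real line meeting the lattice in a
    primitive subgroup, and a holomorphic homomorphism of complex tori lifts to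
    multiplication by a complex number. *)

Require Import Defs.
From HB Require Import structures.
From mathcomp Require Import all_boot all_order all_algebra.
From mathcomp Require Import all_classical all_reals all_analysis.
From mathcomp Require Import complex.
From mathcomp Require Import ring lra zify.

Set Implicit Arguments.
Unset Strict Implicit.
Unset Printing Implicit Defensive.

Import Order.TTheory GRing.Theory Num.Theory numFieldNormedType.Exports.

Local Open Scope classical_set_scope.
Local Open Scope ring_scope.
Local Open Scope complex_scope.

(** With [m = N / h ^ 2], so that [n = m * h], the group is the union of the sets [AL m h e] for e
    in S, which multiply as in Ex(m). Each w_e' lies in the set of its e, because e' = e t^2 with t
    dividing h. Words contain no inverses of generators, so the reduction to Gamma_0(nh) uses
    nonnegative powers of x and y, with exponents found modulo h. Isogenies come with local
    holomorphic lifts only, and [circ] is merely continuous. One construction lifts both in place of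
    covering space theory: the lattice is discrete, so small lifts near 0 are unique, and doubling
    extends them. A solid torus is then recorded by a framing (w, tau), and statements about
    quotients and isogenies become identities between complex numbers. The scale w is harmless, and
    tau is determined up to an integer translation, on which lambda vanishes. That isomorphic tori
    share tau depends on orientation: it is given only through a strictly increasing map r, which
    has to exclude the multiplier -1. *)

(** * Congruences and exact divisors *)

Lemma exists_coprime_addM (h : nat) (d b : int) : (0 < h)%N -> coprimez d b ->
  exists j : nat, coprimez (d - j%:Z * b) h%:Z.
Proof.
move=> h0 db.
pose pi := [pred p : nat | ~~ (p%:Z %| d)%Z].
(* A prime of h divides this j exactly when it does not divide d. As b is prime to d, it divides
   just one of d and j b. *)
exists (h`_pi)%N.
apply: contraT => ncop.
pose g := gcdn (absz (d - (h`_pi)%N%:Z * b)%R) h.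
have g1 : (1 < g)%N.
  rewrite ltn_neqAle eq_sym gcdn_gt0 h0 orbT andbT.
  by move: ncop; rewrite /coprimez /gcdz eqz_nat.
have pP := pdiv_prime g1; set p := pdiv g in pP.
have pg : (p %| g)%N := pdiv_dvd g.
have ph : (p %| h)%N by apply: dvdn_trans pg (dvdn_gcdr _ _).
have pd : (p%:Z %| d - (h`_pi)%N%:Z * b)%Z.
  by rewrite dvdzE /=; apply: dvdn_trans pg (dvdn_gcdl _ _).
have [pdd|pnd] := boolP (p%:Z %| d)%Z; last first.
  have ppart : (p %| h`_pi)%N.
    by rewrite -[p](part_pnat_id (pi := pi)) ?pnatE //; exact: partn_dvd.
  by move: pnd; rewrite -(subrK ((h`_pi)%N%:Z * b) d) rpredD // dvdz_mulr.
have pk : ~~ (p %| h`_pi)%N.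
  apply/negP => /(pnat_dvd) /(_ (part_pnat pi h)).
  by rewrite pnatE // inE /= pdd.
have : (p%:Z %| (h`_pi)%N%:Z * b)%Z.
  by rewrite -[X in (_ %| X)%Z](subKr d) rpredB.
rewrite Gauss_dvdzr; last by rewrite /coprimez /gcdz /= eqz_nat -/(coprime _ _) prime_coprime.
move=> pb; have : (p%:Z %| gcdz d b)%Z by rewrite dvdz_gcd pdd.
by rewrite (eqP db) dvdz1 /= => /eqP p1; move: pP; rewrite p1.
Qed.

Lemma exists_nat_dvd_subM (h : nat) (a b : int) : (0 < h)%N -> coprimez a h%:Z ->
  exists i : nat, (h%:Z %| b - i%:Z * a)%Z.
Proof.
move=> h0 /coprimezP [[u v] /= uv].
have hz : h%:Z != 0 by rewrite eqz_nat -lt0n.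
(* u inverts a modulo h; the residue of u b is taken because i has to be a natural number. *)
exists (absz (u * b %% h%:Z)%Z).
rewrite gez0_abs ?modz_ge0 //.
have E := divz_eq (u * b) h%:Z.
set q := (_ %/ _)%Z in E; set r := (_ %% _)%Z in E *.
apply/dvdzP; exists (q * a + v * b).
have -> : r = u * b - q * h%:Z by rewrite E; ring.
have -> : b - (u * b - q * h%:Z) * a = b - (u * a) * b + q * a * h%:Z by ring.
have -> : u * a = 1 - v * h%:Z by rewrite -uv; ring.
ring.
Qed.

(** An exact divisor is the part of the number supported on its own primes. The primes of e
    contribute e to m and t to h, hence e t^2 to m h^2. *)
Lemma Ex_image_factor (m h e e' : nat) :
  (0 < m)%N -> (0 < h)%N -> exact_div m e -> exact_div (m * h ^ 2) e' ->
  primes e' = primes e -> exists2 t, (t %| h)%N & e' = (e * t ^ 2)%N.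
Proof.
move=> m0 h0 [em ecop] [e'm e'cop] pr.
have e0 : (0 < e)%N := dvdn_gt0 m0 em.
have part_exact k f : (0 < k)%N -> (f %| k)%N -> coprime f (k %/ f) -> (k`_\pi(f) = f)%N.
  move=> k0 fk fc; have f0 := dvdn_gt0 k0 fk.
  have kf0 : (0 < k %/ f)%N by rewrite divn_gt0 // dvdn_leq.
  rewrite -{1}(divnK fk) partnM // partn_pi // part_p'nat ?mul1n //.
  by rewrite -coprime_pi'.
have N0 : (0 < m * h ^ 2)%N by rewrite muln_gt0 m0 expn_gt0 h0.
exists (h`_\pi(e))%N; first exact: dvdn_part.
rewrite -(part_exact _ e' N0 e'm e'cop).
have piE : \pi(e') =i \pi(e) by move=> p; rewrite !inE pr.
rewrite (eq_partn _ piE).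
have h2 : (0 < h ^ 2)%N by rewrite expn_gt0 h0.
rewrite partnM // partnX; congr (_ * _)%N; exact: part_exact.
Qed.

Lemma exists_Ex_image (m h e : nat) :
  (0 < m)%N -> (0 < h)%N -> exact_div m e ->
  exists e', exact_div (m * h ^ 2) e' /\ primes e' = primes e.
Proof.
move=> m0 h0 [em ecop]; have e0 : (0 < e)%N := dvdn_gt0 m0 em.
have N0 : (0 < m * h ^ 2)%N by rewrite muln_gt0 m0 expn_gt0 h0.
set N := (m * h ^ 2)%N in N0 *.
exists (N`_\pi(e))%N; split; first split.
- exact: dvdn_part.
- rewrite -{2}(partnC \pi(e) N0) mulKn ?part_gt0 //; exact: coprime_partC.
rewrite primes_part; apply: (irr_sorted_eq ltn_trans ltnn).
- by apply: sorted_filter (sorted_primes _); exact: ltn_trans.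
- exact: sorted_primes.
move=> p; rewrite mem_filter; apply: andb_idr.
rewrite inE /= !mem_primes => /and3P[-> _ pe] /=; rewrite N0 /=.
by apply: dvdn_trans pe _; apply: dvdn_trans em _; rewrite /N dvdn_mulr.
Qed.

(** * Real two by two matrices acting on the upper half-plane *)

Section Matrices.
Variable R : realType.
Implicit Types (A B : 'M[R]_2) (z : CC R) (k a b c d : R).

Lemma mx2E A : A = mx2 (A 0 0) (A 0 1) (A 1 0) (A 1 1).
Proof.
by apply/matrixP => i j; rewrite mxE; case: (unliftP 0 i) => [i'|] ->;
  case: (unliftP 0 j) => [j'|] ->; rewrite ?(ord1 i') ?(ord1 j') //=;
  congr (A _ _); apply: val_inj.
Qed.

Lemma scale_mx2 k a b c d :
  k *: mx2 a b c d = mx2 (k * a) (k * b) (k * c) (k * d).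
Proof. by rewrite [LHS]mx2E !mxE. Qed.

Lemma mul_mx2 a b c d a' b' c' d' : mx2 a b c d *m mx2 a' b' c' d' =
  mx2 (a * a' + b * c') (a * b' + b * d') (c * a' + d * c') (c * b' + d * d').
Proof.
by rewrite [LHS]mx2E !mxE !big_ord_recl !big_ord0 !addr0 !mxE.
Qed.

Lemma det2 A : \det A = A 0 0 * A 1 1 - A 0 1 * A 1 0.
Proof.
rewrite (expand_det_row _ 0) !big_ord_recl big_ord0 addr0.
rewrite /cofactor !det_mx11 !mxE /= expr0 expr1 mul1r mulN1r mulrN.
by congr (A _ _ * A _ _ - A _ _ * A _ _); apply: val_inj.
Qed.

Lemma det_mx2 a b c d : \det (mx2 a b c d) = a * d - b * c.
Proof. by rewrite det2 !mxE. Qed.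

Lemma moebius_den_neq0 A z : 0 < \det A -> 0 < complex.Im z ->
  (A 1 0)%:C * z + (A 1 1)%:C != 0.
Proof.
case: z => x y; rewrite det2 /= => detA y0; apply/eqP => -[].
rewrite ?(mul0r, subr0, addr0, add0r) => re /eqP.
rewrite mulf_eq0 (gt_eqF y0) orbF => /eqP c0; move: re detA; rewrite c0 mul0r add0r => ->.
by rewrite !mulr0 subrr ltxx.
Qed.

Lemma moebius_Im_gt0 A z : 0 < \det A -> 0 < complex.Im z ->
  0 < complex.Im (moebius A z).
Proof.
move=> detA zi; have den0 := moebius_den_neq0 detA zi.
set D := (A 1 0)%:C * z + (A 1 1)%:C in den0.
(* Multiplying by the conjugate denominator leads to Im (A z) = det A Im z / |D|^2. *)
have -> : moebius A z = ((A 0 0)%:C * z + (A 0 1)%:C) * D^* / (D * D^*).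
  by rewrite /moebius -/D invfM mulrACA mulfV ?mulr1 // conjC_eq0.
have -> : D * D^* = (complex.Re D ^+ 2 + complex.Im D ^+ 2)%:C.
  by rewrite -normCK normc_def -rmorphXn /= sqr_sqrtr ?addr_ge0 ?sqr_ge0.
have D0 : 0 < complex.Re D ^+ 2 + complex.Im D ^+ 2.
  rewrite lt_neqAle addr_ge0 ?sqr_ge0 // andbT eq_sym paddr_eq0 ?sqr_ge0 //.
  rewrite !sqrf_eq0; apply: contra den0 => /andP[/eqP r0 /eqP i0].
  by case: D r0 i0 => r i /= -> ->.
rewrite -rmorphV ?unitfE ?gt_eqF //.
rewrite det2 in detA.
set q := _^-1; have q0 : 0 < q by rewrite invr_gt0.
clearbody q; rewrite /D; clear -detA zi q0; case: z zi => x y /= y0.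
have : 0 < (A 0 0 * A 1 1 - A 0 1 * A 1 0) * y * q by rewrite !mulr_gt0.
by congr (0 < _); ring.
Qed.

Lemma moebiusM A B z : 0 < \det B -> 0 < \det A -> 0 < complex.Im z ->
  moebius (A *m B) z = moebius A (moebius B z).
Proof.
move=> detB detA zi; have dB := moebius_den_neq0 detB zi.
have dAB := moebius_den_neq0 detA (moebius_Im_gt0 detB zi).
rewrite /moebius in dAB *; rewrite !mxE !big_ord_recl !big_ord0 !addr0.
have -> : lift 0 0 = 1 :> 'I_2 by apply: val_inj.
set D := (B 1 0)%:C * z + _ in dB dAB *; set E := (B 0 0)%:C * z + _ in dAB *.
have -> : (A 0 0)%:C * (E / D) + (A 0 1)%:C = ((A 0 0)%:C * E + (A 0 1)%:C * D) / D.
  by rewrite [RHS]mulrDl -mulrA (mulfK dB).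
have ED : (A 1 0)%:C * (E / D) + (A 1 1)%:C = ((A 1 0)%:C * E + (A 1 1)%:C * D) / D.
  by rewrite [RHS]mulrDl -mulrA (mulfK dB).
rewrite ED invf_div mulrA divfK //.
rewrite /E /D !rmorphD !rmorphM /=; congr (_ / _); ring.
Qed.

Lemma moebiusZ k A z : k != 0 -> moebius (k *: A) z = moebius A z.
Proof.
move=> k0; rewrite /moebius !mxE !rmorphM /= -!mulrA -!mulrDr -mulf_div mulfV ?mul1r //.
by rewrite fmorph_eq0.
Qed.

End Matrices.

(** * The pieces of Gamma_0(n|h)+S indexed by exact divisors *)

Section AtkinLehner.
Variables (R : realType) (m h : nat).
Hypotheses (m_gt0 : (0 < m)%N) (h_gt0 : (0 < h)%N).
Implicit Types (A B : 'M[R]_2) (e f : nat).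

(* The elements of Gamma_0(n|h)+S belonging to one given e, where n = m h. *)
Definition AL e : set 'M[R]_2 :=
  [set A | exists (a b c d : int) (k : R),
    [/\ k != 0, a * d * e%:Z - b * c * (m %/ e)%N%:Z = 1
      & A = k *: mx2 (a%:~R * e%:R) (b%:~R / h%:R)
                     (c%:~R * (m%:R * h%:R)) (d%:~R * e%:R)]].

Let h_neq0 : h%:R != 0 :> R. Proof. by rewrite pnatr_eq0 -lt0n. Qed.

Lemma Gamma0_barE (S : set nat) A :
  Gamma0_bar (m * h) h S A <-> exists2 e, S e & AL e A.
Proof.
split=> [[a [b [c [d [e [k [Se k0 det ->]]]]]]]|[e Se [a [b [c [d [k [k0 det ->]]]]]]]].
  by exists e => //; exists a, b, c, d, k; rewrite -natrM -(divnMr (p := h)).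
by exists a, b, c, d, e, k; rewrite divnMr // natrM.
Qed.

Lemma AL_det e A : (e %| m)%N -> AL e A -> 0 < \det A.
Proof.
move=> em [a [b [c [d [k [k0 det ->]]]]]].
have e0 : (0 < e)%N := dvdn_gt0 m_gt0 em.
rewrite detZ det_mx2 mulr_gt0 ?exprn_even_gt0 //.
have mE : m%:R = (m %/ e)%N%:R * e%:R :> R by rewrite -natrM divnK.
have detR : a%:~R * d%:~R * e%:R - b%:~R * c%:~R * (m %/ e)%N%:R = 1 :> R.
  by have /(congr1 (intmul (1 : R))) := det; rewrite rmorphB !rmorphM.
have -> : a%:~R * e%:R * (d%:~R * e%:R) - b%:~R / h%:R * (c%:~R * (m%:R * h%:R)) =
    (a%:~R * d%:~R * e%:R - b%:~R * c%:~R * (m %/ e)%N%:R) * e%:R :> R.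
  by rewrite mE; field.
by rewrite detR mul1r ltr0n.
Qed.

(** With g = gcd(e, f), e = e1 g, f = f1 g and m = r e1 f1 g, the matrix product is divisible by g.
    Moving g into the scalar leaves a matrix of type e1 f1. *)
Lemma AL_mul e f A B : (e %| m)%N -> (f %| m)%N -> AL e A -> AL f B ->
  AL ((e * f) %/ gcdn e f ^ 2) (A *m B).
Proof.
move=> em fm [a [b [c [d [k [k0 det ->]]]]]] [a' [b' [c' [d' [k' [k'0 det' ->]]]]]].
have e0 : (0 < e)%N := dvdn_gt0 m_gt0 em.
have f0 : (0 < f)%N := dvdn_gt0 m_gt0 fm.
have g0 : (0 < gcdn e f)%N by rewrite gcdn_gt0 e0.
have lm : (lcmn e f %| m)%N by rewrite dvdn_lcm em.
move: lm; rewrite /lcmn.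
have := dvdn_gcdl e f; have := dvdn_gcdr e f.
set g := gcdn e f in g0 *.
move=> /dvdnP[f1 fE] /dvdnP[e1 eE]; rewrite fE eE in e0 f0 det det' *.
have -> : (e1 * g * (f1 * g) = e1 * f1 * g * g)%N by lia.
rewrite mulnK // => /dvdnP[r mE].
have -> : (e1 * f1 * g * g = e1 * f1 * (g ^ 2))%N by lia.
rewrite mulnK ?expn_gt0 ?g0 //.
have e10 : (0 < e1)%N by move: e0; rewrite muln_gt0 => /andP[].
have f10 : (0 < f1)%N by move: f0; rewrite muln_gt0 => /andP[].
have me : (m %/ (e1 * g) = f1 * r)%N.
  by rewrite mE (_ : r * (e1 * f1 * g) = f1 * r * (e1 * g))%N ?mulnK //; lia.
have mf : (m %/ (f1 * g) = e1 * r)%N.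
  by rewrite mE (_ : r * (e1 * f1 * g) = e1 * r * (f1 * g))%N ?mulnK //; lia.
have mef : (m %/ (e1 * f1) = g * r)%N.
  rewrite mE (_ : r * (e1 * f1 * g) = g * r * (e1 * f1))%N ?mulnK //; last lia.
  by rewrite muln_gt0 e10.
exists (a * a' * g%:Z + b * c' * r%:Z), (a * e1%:Z * b' + b * d' * f1%:Z),
  (c * a' * f1%:Z + d * e1%:Z * c'), (c * b' * r%:Z + d * d' * g%:Z), (k * k' * g%:R).
rewrite me mf mef in det det' *; split.
- by rewrite !mulf_neq0 // pnatr_eq0 -lt0n.
- rewrite !PoszM in det det' *.
  have : (a * d * (e1%:Z * g%:Z) - b * c * (f1%:Z * r%:Z)) *
     (a' * d' * (f1%:Z * g%:Z) - b' * c' * (e1%:Z * r%:Z)) = 1 by rewrite det det'.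
  by move=> <-; ring.
- rewrite -scalemxAl -scalemxAr scalerA mul_mx2 !scale_mx2 mE !natrM.
  rewrite !rmorphD !rmorphM /=.
  by congr mx2; field.
Qed.

Lemma mx2_1 : mx2 1 0 0 1 = 1%:M :> 'M[R]_2.
Proof. by rewrite [RHS]mx2E !mxE. Qed.

Lemma AL_inv e A : (e %| m)%N -> AL e A -> exists2 B, AL e B & A *m B = 1%:M.
Proof.
move=> em [a [b [c [d [k [k0 det ->]]]]]].
have e0 : (0 < e)%N := dvdn_gt0 m_gt0 em.
have eR : e%:R != 0 :> R by rewrite pnatr_eq0 -lt0n.
have mE : m%:R = (m %/ e)%N%:R * e%:R :> R by rewrite -natrM divnK.
have detR : a%:~R * d%:~R * e%:R - b%:~R * c%:~R * (m %/ e)%N%:R = 1 :> R.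
  by have /(congr1 (intmul (1 : R))) := det; rewrite rmorphB !rmorphM.
exists ((k * e%:R)^-1 *: mx2 (d%:~R * e%:R) ((- b)%:~R / h%:R)
                     ((- c)%:~R * (m%:R * h%:R)) (a%:~R * e%:R)).
  exists d, (- b), (- c), a, (k * e%:R)^-1; split => //.
    by rewrite invr_eq0 mulf_neq0.
  by rewrite -det; ring.
rewrite -scalemxAl -scalemxAr scalerA mul_mx2 scale_mx2 -mx2_1 mE !rmorphN /=.
congr mx2; try by field; rewrite ?k0 ?eR ?h_neq0.
- rewrite -[RHS]detR; field; by rewrite ?k0 ?eR ?h_neq0.
- rewrite -[RHS]detR; field; by rewrite ?k0 ?eR ?h_neq0.
Qed.

Lemma AL_Gamma0 A : Gamma0 (m * h * h) A -> AL 1 A.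
Proof.
move=> [a [b [c [d [k [k0 det ->]]]]]].
exists a, (b * h%:Z), (c * h%:Z), d, k; split=> //.
  by rewrite divn1 -det !PoszM; ring.
by rewrite !rmorphM /= ?natrM; congr (_ *: mx2 _ _ _ _); field.
Qed.

Lemma AL_x : AL 1 (mx_x R h).
Proof.
exists 1, 1, 0, 1, 1; split=> //.
by rewrite scale1r mulr1 mul0r div1r.
Qed.

Lemma AL_y : AL 1 (mx_y R (m * h)).
Proof.
exists 1, 0, 1, 1, 1; split=> //.
by rewrite scale1r mulr1 !mul1r mul0r -natrM.
Qed.

(** With e' = e t^2 and h = s t, the matrix is t times the one of type e with parameters a t, b s, c
    s, d t. *)
Lemma AL_w e e' (a b c d : int) :
  exact_div m e -> exact_div (m * h * h) e' -> primes e' = primes e ->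
  a * d * e'%:Z - b * c * ((m * h * h) %/ e')%N%:Z = 1 ->
  AL e (mx2 (a%:~R * e'%:R) b%:~R (c%:~R * (m * h * h)%:R) (d%:~R * e'%:R)).
Proof.
move=> ex ex' pr det; have := ex'.
rewrite -mulnA mulnn => ex2.
have [t th e'E] := Ex_image_factor m_gt0 h_gt0 ex ex2 pr.
have em : (e %| m)%N by case: ex.
have e0 : (0 < e)%N := dvdn_gt0 m_gt0 em.
have t0 : (0 < t)%N := dvdn_gt0 h_gt0 th.
have tR : t%:R != 0 :> R by rewrite pnatr_eq0 -lt0n.
have [s hE] := dvdnP th; have [r mE] := dvdnP em.
have s0 : s%:R != 0 :> R by move: h_neq0; rewrite hE natrM mulf_eq0 => /norP[].
rewrite e'E in det *.
move: det.
have -> : (m * h * h %/ (e * t ^ 2) = r * s ^ 2)%N.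
  rewrite mE hE (_ : r * e * (s * t) * (s * t) = r * s ^ 2 * (e * t ^ 2))%N; last lia.
  by rewrite mulnK // muln_gt0 e0 expn_gt0 t0.
move=> det; exists (a * t%:Z), (b * s%:Z), (c * s%:Z), (d * t%:Z), t%:R; split=> //.
  by rewrite mE mulnK // -det !PoszM; ring.
by rewrite scale_mx2 mE hE !rmorphM /= ?natrM; congr mx2; field; rewrite ?tR ?s0.
Qed.

End AtkinLehner.

(** * Words in the generators, and lambda on words *)

Section Generation.
Variables (R : realType) (m h : nat) (S : set nat).
Hypotheses (m_gt0 : (0 < m)%N) (h_gt0 : (0 < h)%N).
Hypothesis S_subgroup : Ex_subgroup m S.
Implicit Types (A B g : 'M[R]_2) (gs : seq 'M[R]_2).

Let n := (m * h)%N.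
Let h_neq0 : h%:R != 0 :> R. Proof. by rewrite pnatr_eq0 -lt0n. Qed.
Let S_exact e : S e -> exact_div m e.
Proof. by case: S_subgroup => H _ _; exact: H. Qed.
Let S_dvd e : S e -> (e %| m)%N.
Proof. by move=> /S_exact[]. Qed.

Lemma Gamma0_bar_det A : Gamma0_bar n h S A -> 0 < \det A.
Proof. by move=> /(Gamma0_barE m h_gt0)[e /S_dvd em /(AL_det m_gt0 h_gt0 em)]. Qed.

Lemma Gamma0_bar_mul A B :
  Gamma0_bar n h S A -> Gamma0_bar n h S B -> Gamma0_bar n h S (A *m B).
Proof.
move=> /(Gamma0_barE m h_gt0)[e Se Ae] /(Gamma0_barE m h_gt0)[f Sf Bf].
apply/(Gamma0_barE m h_gt0); exists ((e * f) %/ gcdn e f ^ 2)%N.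
  by case: S_subgroup => _ _; exact.
exact: AL_mul (S_dvd Se) (S_dvd Sf) Ae Bf.
Qed.

Lemma Gamma0_bar_inv A : Gamma0_bar n h S A ->
  exists2 B, Gamma0_bar n h S B & A *m B = 1%:M.
Proof.
move=> /(Gamma0_barE m h_gt0)[e Se /(AL_inv m_gt0 h_gt0 (S_dvd Se))[B Be AB]].
by exists B => //; apply/(Gamma0_barE m h_gt0); exists e.
Qed.

Lemma Gamma0_sub_bar A : Gamma0 (n * h) A -> Gamma0_bar n h S A.
Proof.
move=> /(AL_Gamma0 h_gt0) A1; apply/(Gamma0_barE m h_gt0); exists 1%N => //.
by case: S_subgroup.
Qed.

Definition generator : set 'M[R]_2 :=
  [set g | g = mx_x R h \/ g = mx_y R n \/ mx_w n h S g].

Lemma generator_bar g : generator g -> Gamma0_bar n h S g.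
Proof.
have S1 : S 1%N by case: S_subgroup.
move=> gen; apply/(Gamma0_barE m h_gt0); case: gen => [->|[->|]].
- by exists 1%N => //; exact: AL_x.
- by exists 1%N => //; exact: AL_y.
- move=> [a [b [c [d [e' [[ex' [e Se pr]] det ->]]]]]]; exists e => //.
  exact: AL_w (S_exact Se) ex' pr det.
Qed.

(** The generators are fixed matrices, so the arbitrary scalar of a group element is carried by
    [g0]. *)
Definition word A : Prop := exists gs (g0 : 'M[R]_2),
  [/\ Gamma0 (n * h) g0, forall g, g \in gs -> generator g
    & A = foldr (fun g => mulmx g) g0 gs].

Let word_cons g A : generator g -> word A -> word (g *m A).
Proof.
move=> gg [gs [g0 [Gg0 gsg ->]]]; exists (g :: gs), g0; split=> //.
by move=> g'; rewrite inE => /orP[/eqP->|/gsg].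
Qed.

Let word_x i A : word A -> word (mx2 1 (i%:R / h%:R) 0 1 *m A).
Proof.
move=> wA; elim: i => [|i IH]; first by rewrite mul0r mx2_1 mul1mx.
have -> : mx2 1 (i.+1%:R / h%:R) 0 1 = mx_x R h *m mx2 1 (i%:R / h%:R) 0 1.
  by rewrite mul_mx2 -natr1; congr mx2; field.
by rewrite -mulmxA; apply: word_cons => //; left.
Qed.

Let word_y j A : word A -> word (mx2 1 0 (j%:R * n%:R) 1 *m A).
Proof.
move=> wA; elim: j => [|i IH]; first by rewrite mul0r mx2_1 mul1mx.
have -> : mx2 1 0 (i.+1%:R * n%:R) 1 = mx_y R n *m mx2 1 0 (i%:R * n%:R) 1.
  by rewrite mul_mx2 -natr1; congr mx2; ring.
by rewrite -mulmxA; apply: word_cons => //; right; left.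
Qed.

(* Row operations by powers of x and y: first make d prime to h, then clear b
   and c modulo h. *)
Let word_AL1 A : AL m h 1 A -> word A.
Proof.
move=> [a [b [c [d [k [k0]]]]]]; rewrite mulr1 divn1 => det ->.
have cop0 : coprimez d (m%:Z * b).
  by apply/coprimezP; exists (a, - c); rewrite /= -det; ring.
have [j copj] := exists_coprime_addM h_gt0 cop0.
set d1 := d - j%:Z * (m%:Z * b) in copj; pose c1 := c - j%:Z * a.
have [i hi] := exists_nat_dvd_subM b h_gt0 copj.
have [s sE] := dvdzP hi; pose a2 := a - i%:Z * m%:Z * c1.
have det2 : a2 * d1 - s * h%:Z * c1 * m%:Z = 1.
  by rewrite -sE -det /a2 /c1 /d1; ring.
(* Once the upper right parameter is divisible by h, the determinant makes [a2] a unit modulo h, so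
   a multiple of it can clear [c1]. *)
have cop2 : coprimez a2 h%:Z.
  by apply/coprimezP; exists (d1, - s * c1 * m%:Z); rewrite /= -det2; ring.
have [l hl] := exists_nat_dvd_subM c1 h_gt0 cop2.
have [u uE] := dvdzP hl; pose d3 := d1 - l%:Z * m%:Z * (s * h%:Z).
have wB : word (k *: mx2 a2%:~R s%:~R (u%:~R * (n * h)%:R) d3%:~R).
  exists [::], (k *: mx2 a2%:~R s%:~R (u%:~R * (n * h)%:R) d3%:~R); split=> //.
  exists a2, s, u, d3, k; split=> //; rewrite -det2 /d3 /n !PoszM.
  transitivity (a2 * d3 - s * m%:Z * h%:Z * (u * h%:Z)); first by rewrite /d3; ring.
  by rewrite -uE /d3; ring.
have := word_y j (word_x i (word_y l wB)); congr word.
have dE : d = d1 + j%:Z * m%:Z * b by rewrite /d1; ring.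
have cE : c = c1 + j%:Z * a by rewrite /c1; ring.
have bE : b = s * h%:Z + i%:Z * d1 by rewrite -sE; ring.
have aE : a = a2 + i%:Z * m%:Z * c1 by rewrite /a2; ring.
have c1E : c1 = u * h%:Z + l%:Z * a2 by rewrite -uE; ring.
have d1E : d1 = d3 + l%:Z * m%:Z * (s * h%:Z) by rewrite /d3; ring.
rewrite -!scalemxAr !mul_mx2 dE cE bE aE c1E d1E.
rewrite /n !(rmorphD, rmorphM) /= ?natrM; congr (_ *: mx2 _ _ _ _); field; exact: h_neq0.
Qed.

(** Since e is its own inverse in Ex(m), the inverse of a w_e' of type e moves A into [AL m h 1]. *)
Lemma Gamma0_bar_word A : Gamma0_bar n h S A -> word A.
Proof.
move=> GA; have /(Gamma0_barE m h_gt0)[e Se Ae] := GA.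
have ex := S_exact Se; have em := S_dvd Se.
have e0 : (0 < e)%N := dvdn_gt0 m_gt0 em.
have [e'] := exists_Ex_image m_gt0 h_gt0 ex.
rewrite -mulnn mulnA => -[ex' pr].
(* Exactness of e' is a Bezout relation, which provides a w_e' with a = c = 1. *)
have : coprimez e'%:Z ((m * h * h) %/ e')%N%:Z
  by rewrite /coprimez /gcdz /= eqz_nat; case: ex'.
move=> /coprimezP[[u v] /= uv].
have det : 1 * u * e'%:Z - (- v) * 1 * ((m * h * h) %/ e')%N%:Z = 1 by rewrite -[RHS]uv; ring.
set w := mx2 (1%:~R * e'%:R) (- v)%:~R (1%:~R * (m * h * h)%:R) (u%:~R * e'%:R) : 'M[R]_2.
have wgen : generator w.
  right; right; exists 1, (- v), 1, u, e'; split=> //.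
  by split=> //; exists e.
have ALw : AL m h e w := AL_w R m_gt0 h_gt0 ex ex' pr det.
have [w' ALw' ww'] := AL_inv m_gt0 h_gt0 em ALw.
rewrite -[A]mul1mx -ww' -mulmxA; apply: word_cons => //; apply: word_AL1.
by have := AL_mul m_gt0 h_gt0 em em ALw' Ae; rewrite gcdnn mulnn divnn expn_gt0 e0.
Qed.

Lemma word_bar gs (g0 : 'M[R]_2) : Gamma0 (n * h) g0 ->
  (forall g, g \in gs -> generator g) ->
  Gamma0_bar n h S (foldr (fun g => mulmx g) g0 gs).
Proof.
move=> Gg0; elim: gs => [_|g gs IH gen] /=; first exact: Gamma0_sub_bar.
apply: Gamma0_bar_mul; first by apply/generator_bar/gen; rewrite mem_head.
by apply: IH => g' g'gs; apply: gen; rewrite inE g'gs orbT.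
Qed.

Lemma moebius_word gs (g0 : 'M[R]_2) (z : CC R) : 0 < complex.Im z ->
  Gamma0 (n * h) g0 -> (forall g, g \in gs -> generator g) ->
  moebius (foldr (fun g => mulmx g) g0 gs) z = foldr (@moebius R) (moebius g0 z) gs.
Proof.
move=> zi Gg0; elim: gs => //= g gs IH gen.
have gen' g' : g' \in gs -> generator g' by move=> g'gs; apply: gen; rewrite inE g'gs orbT.
rewrite moebiusM ?IH //; first exact/Gamma0_bar_det/word_bar.
by apply/Gamma0_bar_det/generator_bar/gen; rewrite mem_head.
Qed.

Variable lam : 'M[R]_2 -> int.
Hypothesis lam_lambda : is_lambda n h S lam.

Lemma lam_word gs (g0 : 'M[R]_2) : Gamma0 (n * h) g0 ->
  (forall g, g \in gs -> generator g) ->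
  (lam (foldr (fun g => mulmx g) g0 gs) = (\sum_(g <- gs) lam g)%R %[mod h%:Z])%Z.
Proof.
case: lam_lambda => lamM lam0 _ _ _.
move=> Gg0; elim: gs => [_|g gs IH gen] /=; first by rewrite big_nil lam0.
have gen' g' : g' \in gs -> generator g' by move=> g'gs; apply: gen; rewrite inE g'gs orbT.
rewrite big_cons lamM; first by rewrite -modzDmr IH // modzDmr.
  by apply/generator_bar/gen; rewrite mem_head.
exact: word_bar.
Qed.

Lemma Gamma0_dbar_mul A B : Gamma0_dbar n h S lam A -> Gamma0_dbar n h S lam B ->
  Gamma0_dbar n h S lam (A *m B).
Proof.
case: lam_lambda => lamM _ _ _ _ [GA A0] [GB B0].
split; first exact: Gamma0_bar_mul.
by rewrite lamM // -modzDm A0 B0 !mod0z.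
Qed.

Lemma Gamma0_dbar_sub A : Gamma0 (n * h) A -> Gamma0_dbar n h S lam A.
Proof.
by case: lam_lambda => _ lam0 _ _ _ GA; split; [exact: Gamma0_sub_bar|exact: lam0].
Qed.

Lemma Gamma0_translation (k : int) : Gamma0 (n * h) (mx2 1 k%:~R 0 1 : 'M[R]_2).
Proof.
exists 1, k, 0, 1, 1; split=> //; first by rewrite mulr0 mul0r subr0 mulr1.
by rewrite scale1r mul0r.
Qed.

Lemma Gamma0_dbar_inv A : Gamma0_dbar n h S lam A ->
  exists2 B, Gamma0_dbar n h S lam B & B *m A = 1%:M.
Proof.
case: lam_lambda => lamM lam0 _ _ _ [GA A0].
have [B GB AB] := Gamma0_bar_inv GA; exists B; last exact: mulmx1C.
split=> //.
have : (lam (A *m B) = 0 %[mod h%:Z])%Z.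
  by rewrite AB -mx2_1; apply: lam0; exact: (Gamma0_translation 0).
by rewrite lamM // -modzDml A0 mod0z add0r.
Qed.

End Generation.

(** * Lifting additive maps to the plane, and their linearity *)

Section AdditiveMaps.
Variable R : realType.
Implicit Types (E : ellCurve R) (z : CC R) (t : R).

Lemma ger0_complexE z : 0 <= z -> z = (complex.Re z)%:C.
Proof. by case: z => x y; rewrite lecE /= => /andP[/eqP-> _]. Qed.

Lemma gtr0_complexE z : 0 < z -> z = (complex.Re z)%:C /\ 0 < complex.Re z.
Proof.
move=> z0; have zE := ger0_complexE (ltW z0); split=> //.
by move: z0; rewrite zE (ltcR 0).
Qed.

Lemma exists_lt_mul_exp2 (z d : CC R) : 0 < d ->
  exists k, forall j, (k <= j)%N -> `|z| < d * 2 ^+ j.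
Proof.
move=> /gtr0_complexE[-> d0].
rewrite (ger0_complexE (normr_ge0 z)).
exists (Num.bound (complex.Re `|z| / complex.Re d)) => j kj.
have := upper_nthrootP kj; rewrite ltr_pdivrMr // mulrC => H.
by rewrite -(rmorph_nat (real_complex R)) -rmorphXn -rmorphM ltcR.
Qed.

Lemma normc_archi_eq0 (z B : CC R) : (forall k : nat, `|z| *+ k <= B) -> z = 0.
Proof.
move=> H; apply/eqP; rewrite -normr_eq0 eq_le normr_ge0 andbT; apply/negPn/negP => z0.
have {}z0 : 0 < `|z| by rewrite lt_def normr_ge0 andbT normr_eq0; apply: contra z0 => /eqP->;
  rewrite normr0.
have [k /(_ k (leqnn k))] := exists_lt_mul_exp2 B z0.
have B0 : 0 <= B by have := H 0%N; rewrite mulr0n.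
rewrite ger0_norm // -natrX mulr_natr => lt.
by have := lt_le_trans lt (H _); rewrite ltxx.
Qed.

Lemma floor_frac_itv t : 0 <= t - (Num.floor t)%:~R < 1.
Proof.
have /andP[a b] := floor_itv t; rewrite subr_ge0 a /=.
by rewrite ltrBlDl; rewrite rmorphD /= in b.
Qed.

Lemma zmod_morphMn (U V : zmodType) (f : U -> V) : zmod_morphism f ->
  forall x k, f (x *+ k) = f x *+ k.
Proof.
move=> fB; have f0 : f 0 = 0 by rewrite -[0 in LHS](subrr 0) fB subrr.
have fN x : f (- x) = - f x by rewrite -[- x]sub0r fB f0 sub0r.
move=> x; elim=> [|k IH]; first by rewrite !mulr0n.
by rewrite !mulrSr -[X in f (_ + X)]opprK fB IH fN opprK.
Qed.

Lemma zmod_morph0 (U V : zmodType) (f : U -> V) : zmod_morphism f -> f 0 = 0.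
Proof. by move=> fB; rewrite -[0 in LHS](subrr 0) fB subrr. Qed.

Lemma zmod_morphMz (U V : zmodType) (f : U -> V) : zmod_morphism f ->
  forall x (k : int), f (x *~ k) = f x *~ k.
Proof.
move=> fB x [k|k]; first exact: zmod_morphMn.
by rewrite !NegzE !mulrNz -sub0r fB zmod_morph0 // sub0r (zmod_morphMn fB).
Qed.

(* Near 0 the small lift is unique and hence additive; it is extended to all of
   the plane by G z = 2^k g(z / 2^k). *)
Lemma additive_lift E (phi : CC R -> pts E) : zmod_morphism phi ->
  (forall rho : CC R, 0 < rho -> exists2 delta : CC R, 0 < delta &
     forall z, `|z| < delta -> exists2 u, `|u| < rho & phi z = pr E u) ->
  exists G : CC R -> CC R, [/\ zmod_morphism G, forall z, phi z = pr E (G z)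
    & exists delta B : CC R, 0 < delta /\ forall z, `|z| < delta -> `|G z| < B].
Proof.
move=> phiB small; have [r r0 rP] := lattice_discrete E.
(* A quarter suffices: testing additivity adds up three small lifts, and the result must stay below
   the discreteness bound r. *)
have r40 : 0 < r / 4%:R by rewrite divr_gt0.
have [delta d0 dP] := small _ r40.
have ex z : exists u, `|z| < delta -> `|u| < r / 4%:R /\ phi z = pr E u.
  have [zd|] := boolP (`|z| < delta); last by exists 0.
  by have [u ur uE] := dP z zd; exists u.
have [g gP] := choice ex.
have gB y z : `|y| < delta -> `|z| < delta -> `|y - z| < delta ->
    g (y - z) = g y - g z.
  move=> /gP[gy yE] /gP[gz zE] /gP[gyz yzE]; apply/eqP; rewrite -subr_eq0; apply/eqP.
  apply: rP; first by rewrite -prE prB -yE -zE -yzE phiB.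
  rewrite (le_lt_trans (ler_normB _ _)) //.
  have -> : r = r / 4%:R + (r / 4%:R + r / 4%:R) + r / 4%:R by field.
  rewrite -[ltLHS]addr0; apply: ltrD => //; apply: ltrD => //.
  by rewrite (le_lt_trans (ler_normB _ _)) //; apply: ltrD.
have half z : `|z| < delta -> `|z / 2| < delta.
  move=> zd; rewrite normf_div (ger0_norm (ler0n _ 2)) ltr_pdivrMr //.
  by rewrite (lt_le_trans zd) // ler_peMr ?ler1n // ltW.
(* Halving stays inside the disc, and y - y / 2 = y / 2 gives g y = 2 g (y / 2); so the extension is
   independent of the exponent. *)
have gk z k j : `|z / 2 ^+ k| < delta ->
    g (z / 2 ^+ k) *+ 2 ^ k = g (z / 2 ^+ (k + j)) *+ 2 ^ (k + j).
  move=> zk; have zj i : `|z / 2 ^+ (k + i)| < delta.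
    elim: i => [|i IH]; first by rewrite addn0.
    by rewrite addnS exprSr invfM mulrA half.
  elim: j => [|j ->]; first by rewrite addn0.
  rewrite addnS expnS mulnC mulrnA.
  set y := z / _; have -> : z / 2 ^+ (k + j).+1 = y / 2 by rewrite exprSr invfM mulrA.
  have yd : `|y| < delta := zj j; have hy := half _ yd.
  have yE : y - y / 2 = y / 2 by field.
  rewrite mulrnAC; congr (_ *+ _).
  by rewrite mulr2n -{1}yE gB ?yE // subrK.
have ex2 z : exists k, forall j, (k <= j)%N -> `|z / 2 ^+ j| < delta.
  have [k kP] := exists_lt_mul_exp2 z d0; exists k => j /kP.
  by rewrite normf_div normrX (ger0_norm (ler0n _ 2)) ltr_pdivrMr // exprn_gt0.
have [K KP] := choice ex2.
pose G z := g (z / 2 ^+ K z) *+ 2 ^ K z.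
have GE z k : `|z / 2 ^+ k| < delta -> G z = g (z / 2 ^+ k) *+ 2 ^ k.
  move=> zk; rewrite /G (gk _ _ k) ?KP // (gk z k (K z)) //.
  by rewrite (addnC k).
exists G; split.
- move=> y z; pose k := (K y + K z + K (y - z)%R)%N.
  have yk : `|y / 2 ^+ k| < delta by apply: KP; rewrite /k -addnA leq_addr.
  have zk : `|z / 2 ^+ k| < delta by apply: KP; rewrite /k addnAC leq_addl.
  have yzk : `|(y - z) / 2 ^+ k| < delta by apply: KP; rewrite /k leq_addl.
  by rewrite !(GE _ k) // -mulrnBl mulrBl gB // -mulrBl.
- move=> z; have zk := KP z _ (leqnn _).
  have [_ E1] := gP _ zk; rewrite /G prMn -E1 -(zmod_morphMn phiB).
  by rewrite -[_ *+ 2 ^ _]mulr_natr natrX divfK // expf_neq0.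
- exists delta, (r / 4%:R); split=> // z zd.
  by rewrite (GE z 0%N) ?expr0 ?divr1 // expn0 mulr1n; case: (gP z zd).
Qed.

(** Cauchy's argument: with s the fractional part of t j, the error G (t z) - t G z multiplied by j
    equals G (s z) - s G z, which is bounded independently of j. *)
Lemma bounded_additive_linear (G : CC R -> CC R) (delta B : CC R) :
  zmod_morphism G -> 0 < delta -> (forall z, `|z| < delta -> `|G z| < B) ->
  forall t z, G (t%:C * z) = t%:C * G z.
Proof.
move=> GB d0 bnd t z; apply/eqP; rewrite -subr_eq0; apply/eqP.
have [k kP] := exists_lt_mul_exp2 z d0.
have bnd01 s : 0 <= s < 1 -> `|G (s%:C * z)| <= B *+ 2 ^ k.
  move=> /andP[s0 s1].
  have E : s%:C * z = (s%:C * z / 2 ^+ k) *+ 2 ^ k.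
    by rewrite -[RHS]mulr_natr natrX divfK // expf_neq0.
  rewrite E (zmod_morphMn GB) normrMn lerMn2r; apply/orP; right; apply/ltW/bnd.
  rewrite normf_div normrX (ger0_norm (ler0n _ 2)) ltr_pdivrMr ?exprn_gt0 //.
  rewrite (le_lt_trans _ (kP _ (leqnn _))) // normrM ler_piMl //.
  by rewrite normc_def /= expr0n /= addr0 sqrtr_sqr ger0_norm // (lecR _ 1) ltW.
apply: (@normc_archi_eq0 _ (B *+ 2 ^ k + `|G z|)) => j.
set x := t *+ j; pose s := x - (Num.floor x)%:~R.
have s01 : 0 <= s < 1 := floor_frac_itv x.
have sE : s%:C = t%:C *+ j - 1 *~ Num.floor x.
  by rewrite /s /x rmorphB rmorphMn /= rmorph_int.
have -> : `|G (t%:C * z) - t%:C * G z| *+ j = `|G (s%:C * z) - s%:C * G z|.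
  rewrite -normrMn; congr `|_|.
  rewrite sE !mulrBl !mulrnAl !mulrzAl !mul1r GB (zmod_morphMn GB) (zmod_morphMz GB).
  by rewrite mulrnBl opprB addrA subrK.
rewrite (le_trans (ler_normB _ _)) // lerD ?bnd01 //.
case/andP: s01 => s0 s1; rewrite normrM ler_piMl //.
by rewrite normc_def /= expr0n /= addr0 sqrtr_sqr ger0_norm // (lecR _ 1) ltW.
Qed.

End AdditiveMaps.

(** * Lifts of isogenies and of oriented circles *)

Section Lifts.
Variable R : realType.
Implicit Types (E : ellCurve R) (z : CC R) (t : R) (T : solidTorus R).

Lemma real_linearE (G : CC R -> CC R) :
  zmod_morphism G -> (forall t z, G (t%:C * z) = t%:C * G z) ->
  forall z, G z = (complex.Re z)%:C * G 1 + (complex.Im z)%:C * G 'i.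
Proof.
move=> GB GR z.
have GD u v : G (u + v) = G u + G v.
  by have := GB (u + v) v; rewrite addrK => ->; rewrite subrK.
rewrite -!GR -GD; congr G.
by case: z => x y; rewrite mulr1; congr Complex; rewrite /=; ring.
Qed.

(** The additive lift G is real-linear and near 0 differs from the holomorphic lift g by the
    constant [g 0]; the complex derivative of g then forces [G u = u * l] in every direction u. *)
Lemma isogeny_lift E' E (f : pts E' -> pts E) : isogeny f ->
  exists2 alpha : CC R, alpha != 0 & forall z, f (pr E' z) = pr E (alpha * z).
Proof.
move=> [fB fhol [p fp]].
have [g [gder gf]] := fhol 0.
have gd0 : derivable g 0 1 := nbhs_singleton gder.
have g0L : pr E (g 0) = 0.
  by rewrite -(nbhs_singleton gf) /pr raddf0 zmod_morph0.
have gcont : g z @[z --> (0 : CC R)] --> g 0.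
  exact/differentiable_continuous/derivable1_diffP.
pose phi z := f (pr E' z).
have phiB : zmod_morphism phi by move=> y z; rewrite /phi prB fB.
have near0 (rho : CC R) : 0 < rho ->
    \forall z \near (0 : CC R), `|g z - g 0| < rho /\ phi z = pr E (g z).
  move=> rho0; near=> z; split; last by near: z.
  by near: z; have /cvgrPdistC_lt := gcont; apply.
have [|G [GB phiE [delta [B [d0 bnd]]]]] := @additive_lift _ E phi phiB.
  move=> rho rho0; have /nbhs_norm0P[delta /= d0 dP] := near0 _ rho0.
  exists delta => // z /dP[lt zE]; exists (g z - g 0) => //.
  by rewrite prB g0L subr0.
have GR := bounded_additive_linear GB d0 bnd.
have [r r0 rP] := lattice_discrete E.
have r2 : 0 < r / 2 by rewrite divr_gt0.
(* G z and g z - g 0 lift the same map, so they differ by a lattice element; both being below r / 2,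
   it vanishes. *)
have gG : \forall z \near (0 : CC R), g z = g 0 + G z.
  have [k kP] := exists_lt_mul_exp2 B r2.
  have B0 : 0 < B by apply: le_lt_trans (bnd 0 _); rewrite ?normr0.
  have e0 : 0 < delta / 2 ^+ k by rewrite divr_gt0 ?exprn_gt0.
  have Gs z : `|z| < delta / 2 ^+ k -> `|G z| < r / 2.
    rewrite ltr_pdivlMr ?exprn_gt0 // => zlt.
    have : `|G (z *+ 2 ^ k)| < B.
      by apply: bnd; rewrite normrMn -(mulr_natr _ (2 ^ k)) natrX.
    rewrite (zmod_morphMn GB) normrMn -(mulr_natr _ (2 ^ k)) natrX => lt.
    rewrite -(ltr_pM2r (x := 2 ^+ k)) ?exprn_gt0 //; apply: lt_trans lt _.
    by rewrite -[B in B < _]gtr0_norm // kP.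
  near=> z.
  have [glt gE] : `|g z - g 0| < r / 2 /\ phi z = pr E (g z) by near: z; exact: near0.
  have zlt : `|G z| < r / 2.
    by apply: Gs; near: z; apply/(@nbhs_norm0P (CC R) (CC R)); exists (delta / 2 ^+ k).
  apply/eqP; rewrite -subr_eq0 opprD addrA; apply/eqP; apply: rP.
    by rewrite -[_ \in _]pr_eq0 !prB -gE phiE g0L subr0 subrr.
  rewrite (le_lt_trans (ler_normB _ _)) // (splitr r) ltrD //.
have /cvg_ex[l /cvgrPdist_lt lP] := gd0.
have dirl (u : CC R) : u != 0 -> G u = u * l.
  move=> u0; apply/eqP; rewrite -subr_eq0; apply/eqP.
  apply: (@normc_archi_eq0 _ _ `|u|) => j.
  have ej : (0 : CC R) < j.+1%:R^-1 by rewrite invr_gt0 ltr0n.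
  have := lP _ ej; rewrite near_withinE => /nbhs_norm0P[d1 /= d10 d1P].
  have /nbhs_norm0P[d2 /= d20 d2P] := gG.
  have [k1 k1P] := exists_lt_mul_exp2 u d10; have [k2 k2P] := exists_lt_mul_exp2 u d20.
  (* By additivity the difference quotient of G at u / 2^k is G u / u for every k, while u / 2^k
     tends to 0. *)
  pose k := (k1 + k2)%N; pose v := u / 2 ^+ k.
  have k20 : (2 ^+ k : CC R) != 0 by rewrite expf_neq0.
  have v0 : v != 0 by rewrite mulf_neq0 ?invr_eq0.
  have vE : `|v| = `|u| / 2 ^+ k by rewrite normf_div normrX (ger0_norm (ler0n _ 2)).
  have v1 : `|v| < d1 by rewrite vE ltr_pdivrMr ?exprn_gt0 // k1P ?leq_addr.
  have v2 : `|v| < d2 by rewrite vE ltr_pdivrMr ?exprn_gt0 // k2P ?leq_addl.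
  have Gv : G u = G v * 2 ^+ k.
    by rewrite -natrX mulr_natr -(zmod_morphMn GB) -(mulr_natr v) natrX divfK.
  have := d1P v v1 v0; rewrite /= /shift /= addr0 scaler1 (d2P v v2) addrAC subrr add0r.
  have -> : v^-1 *: G v = G u / u.
    by rewrite Gv /v invfM invrK /GRing.scale /=; field; rewrite u0.
  move=> lt; have -> : `|G u - u * l| = `|u| * `|l - G u / u|.
    by rewrite -normrM mulrBr [u * (_ / _)]mulrC divfK // distrC.
  rewrite -mulrnAr ler_piMr // -mulr_natr.
  rewrite (le_trans (ler_wpM2r (ler0n _ j) (ltW lt))) // mulrC ler_pdivrMr ?ltr0n //.
  by rewrite mul1r ler_nat.
have Gi : G 'i = 'i * G 1.
  by rewrite !dirl ?mul1r ?oner_neq0 // neq0Ci.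
have GC z : G z = G 1 * z.
  rewrite (real_linearE GB GR) Gi.
  case: z => x y /=; set a := G 1.
  have -> : (x +i* y : CC R) = x%:C + y%:C * 'i by congr Complex; rewrite /=; ring.
  ring.
exists (G 1) => [|z]; last by rewrite -GC -phiE.
apply: contra fp => /eqP G1.
by rewrite -(Defs.liftK p) -/(phi _) phiE GC G1 mul0r /pr raddf0.
Unshelve. all: by end_near.
Qed.

(** Openness in the quotient topology is openness of the preimage, here a union of lattice
    translates of a ball. *)
Lemma pr_ball_open E (rho : CC R) :
  @open (tpts E) [set p | exists2 u, `|u| < rho & p = pr E u].
Proof.
suff : open [set z : CC R | exists2 u : CC R, `|u| < rho & pr E z = pr E u] by [].
rewrite openE /= => z [u ur zu]; rewrite /interior.
have ru : 0 < rho - `|u| by rewrite subr_gt0.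
apply/nbhs_ballP; exists (rho - `|u|) => // y; rewrite /ball /= => yz.
exists (u + (y - z)).
  by rewrite (le_lt_trans (ler_normD _ _)) // -ltrBrDl distrC.
apply/eqP; rewrite prE.
by have -> : y - (u + (y - z)) = z - u; [ring | rewrite -prE zu].
Qed.

Lemma circ_lift T : exists w : CC R, forall t, circ T t = pr (curve T) (t%:C * w).
Proof.
(* The real part extends [circ T] to the plane, where [additive_lift] applies; w is the value of the
   lift at 1. *)
pose phi z := circ T (complex.Re z).
have phiB : zmod_morphism phi.
  by move=> y z; rewrite /phi raddfB /= circ_morph.
have [|G [GB phiE [delta [B [d0 bnd]]]]] := @additive_lift _ (curve T) phi phiB.
  move=> rho rho0.
  have nb : nbhs (circ T 0 : tpts (curve T))
      [set p | exists2 u, `|u| < rho & p = pr (curve T) u].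
    apply: open_nbhs_nbhs; split; first exact: pr_ball_open.
    exists 0; first by rewrite normr0.
    by rewrite /pr raddf0 zmod_morph0 //; exact: circ_morph.
  have := @circ_cont _ T 0 _ nb; move=> /nbhs_norm0P[delta /= d0 dP].
  exists delta%:C; first by rewrite (ltcR 0).
  move=> z zd; apply: dP => /=; rewrite -ltcR.
  by apply: le_lt_trans zd; exact: normc_ge_Re.
have GR := bounded_additive_linear GB d0 bnd.
by exists (G 1) => t; rewrite -GR mulr1 -phiE.
Qed.

End Lifts.

(** * Lattice bases adapted to the circle *)

Section LatticeBasis.
Variable R : realType.
Implicit Types (E : ellCurve R) (u w z : CC R) (t : R).

Lemma normc_leD z : `|z| <= (`|complex.Re z| + `|complex.Im z|)%:C.
Proof.
rewrite normc_def lecR -[complex.Re z ^+ 2]real_normK ?num_real //.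
rewrite -[complex.Im z ^+ 2]real_normK ?num_real //.
have := normr_ge0 (complex.Im z); have := normr_ge0 (complex.Re z).
move: `|complex.Re z| `|complex.Im z| => a b a0 b0.
rewrite -[leRHS](ger0_norm (addr_ge0 a0 b0)) -sqrtr_sqr ler_wsqrtr //.
have : 0 <= a * b by rewrite mulr_ge0.
nra.
Qed.

Lemma ReZ t z : complex.Re (t%:C * z) = t * complex.Re z.
Proof. by case: z => x y /=; ring. Qed.

Lemma ImZ t z : complex.Im (t%:C * z) = t * complex.Im z.
Proof. by case: z => x y /=; ring. Qed.

Lemma intr_complexE (k : int) : k%:~R = (k%:~R : R)%:C :> CC R.
Proof. by rewrite rmorph_int. Qed.

Lemma real_complexP z : complex.Im z = 0 -> z = (complex.Re z)%:C.
Proof. by case: z => x y /= ->. Qed.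

Section Primitive.
Variables (E : ellCurve R) (w : CC R).
Hypothesis w_neq0 : w != 0.
Hypothesis w_prim : forall t, t%:C * w \in lattice E <-> t \is a Num.int.

(** The lattice scaled by 1 / w, so that the circle becomes R modulo Z: by [w_prim] the real
    elements of M are the integers. *)
Let M u := u * w \in lattice E.

Let MB u v : M u -> M v -> M (u - v).
Proof. by rewrite /M mulrBl; exact: rpredB. Qed.

Let MZ u (k : int) : M u -> M (k%:~R * u).
Proof. by rewrite /M -mulrA mulrzl; exact: rpredMz. Qed.

Let M_int (k : int) : M k%:~R.
Proof. by rewrite /M intr_complexE; apply/w_prim; rewrite intr_int. Qed.

Let M_real u : M u -> complex.Im u = 0 -> exists k : int, u = k%:~R.
Proof.
move=> Mu /real_complexP uE; move: Mu; rewrite /M uE => /w_prim/intrP[k kE].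
by exists k; rewrite uE kE intr_complexE.
Qed.

Let M_discrete : exists2 r : R, 0 < r &
  forall u, M u -> `|complex.Re u| + `|complex.Im u| < r -> u = 0.
Proof.
have [eps eps0 H] := lattice_discrete E.
have w0 : 0 < `|w| by rewrite normr_gt0.
have q0 : 0 < eps / `|w| by rewrite divr_gt0.
have [qE r0] := gtr0_complexE q0.
exists (complex.Re (eps / `|w|)) => // u Mu; rewrite -ltcR -qE => lt.
have := le_lt_trans (normc_leD u) lt; rewrite ltr_pdivlMr // -normrM => /(H _ Mu)/eqP.
by rewrite mulf_eq0 (negPf w_neq0) orbF => /eqP.
Qed.

Let M_pos : exists2 u, M u & 0 < complex.Im u.
Proof.
have [w1 [w2 [w1L w2L span]]] := lattice_span E.
have Mdiv v : v \in lattice E -> M (v / w) by rewrite /M divfK.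
have key v : v \in lattice E -> complex.Im (v / w) != 0 -> exists2 u, M u & 0 < complex.Im u.
  move=> vL; case: ltgtP => // vi _; last by exists (v / w) => //; exact: Mdiv.
  exists (0 - v / w); first by apply: MB; [exact: (M_int 0)|exact: Mdiv].
  by rewrite raddfB /= sub0r oppr_gt0.
(* The two spanning vectors cannot both be real multiples of w, since ['i * w] is a real combination
   of them. *)
have [i1|] := eqVneq (complex.Im (w1 / w)) 0; last exact: key.
have [i2|] := eqVneq (complex.Im (w2 / w)) 0; last exact: key.
have [a [b ab]] := span ('i * w).
have : complex.Im ('i : CC R) = 0.
  rewrite -['i](mulfK w_neq0) ab mulrDl raddfD /= -!mulrA.
  by rewrite [LHS](congr2 +%R (ImZ a (w1 / w)) (ImZ b (w2 / w))) i1 i2 !mulr0 addr0.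
by move/eqP; rewrite oner_eq0.
Qed.

(* Pigeonhole: among the fractional parts of 0, Re u, ..., K Re u two are
   closer than 1 / K. *)
Let M_Im_lb : exists2 e : R, 0 < e &
  forall u, M u -> 0 < complex.Im u -> e <= complex.Im u.
Proof.
have [r r0 rP] := M_discrete.
pose K := (Num.bound (2 / r)).+1.
have K0 : 0 < K%:R :> R by rewrite ltr0n.
have Kr : K%:R^-1 < r / 2.
  rewrite -[r / 2]invrK ltf_pV2 ?posrE ?invr_gt0 ?divr_gt0 // invf_div.
  have r2 : 0 <= 2 / r by rewrite divr_ge0 // ltW.
  by apply: lt_trans (archi_boundP r2) _; rewrite ltr_nat.
(* If Im u were smaller, some multiple of u by at most K would have imaginary part below r / 2 and,
   modulo Z, real part below 1 / K < r / 2, against discreteness. *)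
exists (r / 2 / K%:R); first by rewrite !divr_gt0.
move=> u Mu ui; rewrite leNgt; apply/negP => ult.
pose fr (j : 'I_K.+1) := complex.Re u * j%:R - (Num.floor (complex.Re u * j%:R))%:~R.
have frP j : 0 <= fr j < 1 := floor_frac_itv _.
have box j : (`|Num.floor (K%:R * fr j)| < K)%N.
  case/andP: (frP j) => f0 f1.
  have fl0 : 0 <= Num.floor (K%:R * fr j) by rewrite floor_ge0 mulr_ge0 // ltW.
  rewrite -ltz_nat gez0_abs // -(ltr_int R) (le_lt_trans (floor_le _)) //.
  by rewrite -[ltRHS]mulr1 ltr_pM2l.
pose F j : 'I_K := Ordinal (box j).
have /injectivePn[j [j' jj' FE]] : ~~ injectiveb F.
  by apply/negP => /injectiveP/leq_card; rewrite !card_ord ltnn.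
wlog lt : j j' jj' FE / (j < j')%N.
  move=> H; have [|lt|E'] := ltngtP j j'; first exact: H.
    by apply: (H j' j) => //; rewrite eq_sym.
  by move: jj'; rewrite (val_inj E') eqxx.
have {}FE : Num.floor (K%:R * fr j) = Num.floor (K%:R * fr j').
  have /(congr1 val)/= := FE; case/andP: (frP j) => f0 _; case/andP: (frP j') => f'0 _.
  by move/(congr1 Posz); rewrite !gez0_abs ?floor_ge0 ?mulr_ge0 // ltW.
pose q := Num.floor (complex.Re u * j'%:R) - Num.floor (complex.Re u * j%:R).
pose v := (j' - j)%N%:Z%:~R * u - q%:~R.
have Mv : M v by apply: MB => //; exact: MZ.
have vr : complex.Re v = fr j' - fr j.
  rewrite /v raddfB /= !intr_complexE ReZ /= /fr /q -pmulrn natrB ?(ltnW lt) // rmorphB /=.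
  by ring.
have vi : complex.Im v = (j' - j)%N%:R * complex.Im u.
  by rewrite /v raddfB /= !intr_complexE ImZ /= subr0 -pmulrn.
have vi0 : 0 < complex.Im v by rewrite vi mulr_gt0 // ltr0n subn_gt0.
have : v = 0.
  apply: rP => //; rewrite (splitr r) ltrD //.
    rewrite vr (lt_trans _ Kr) // -[ltRHS]mul1r ltr_pdivlMr //.
    rewrite -(gtr0_norm K0) -normrM mulrC mulrBr.
    have /andP[a1 b1] := floor_itv (K%:R * fr j).
    have /andP[a2 b2] := floor_itv (K%:R * fr j').
    rewrite -FE in a2 b2; rewrite !rmorphD /= in b1 b2.
    by rewrite ltr_norml; apply/andP; split; lra.
  rewrite gtr0_norm // vi; have : (j' - j)%N%:R <= K%:R :> R.
    by rewrite ler_nat (leq_trans (leq_subr _ _)) // -ltnS.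
  move=> jK; rewrite (le_lt_trans (ler_wpM2r (ltW ui) jK)) //.
  by rewrite mulrC -ltr_pdivlMr.
by move=> v0; move: vi0; rewrite v0 ltxx.
Qed.

(** tau has the least positive imaginary part in M. The gap [e] turns an approximate infimum into a
    minimum: a smaller Im u would give tau - u a positive imaginary part below e. Division with
    remainder by Im tau leaves a real element of M, an integer. *)
Lemma primitive_basis : exists2 tau, 0 < complex.Im tau &
  forall z, z \in lattice E <-> exists a b : int, z = w * (a%:~R * tau + b%:~R).
Proof.
have [e e0 eP] := M_Im_lb; have [u0 Mu0 u00] := M_pos.
pose A := [set y | exists2 u, M u /\ 0 < complex.Im u & y = complex.Im u].
have Ainf : has_inf A.
  split; first by exists (complex.Im u0), u0.
  by exists 0 => _ [u [_ /ltW ? ->]].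
have [_ [tau [Mt ti ->]] tlt] := inf_adherent e0 Ainf.
have tau_min u : M u -> 0 < complex.Im u -> complex.Im tau <= complex.Im u.
  move=> Mu ui; rewrite leNgt; apply/negP => lt.
  have : inf A <= complex.Im u by apply: ge_inf; [case: Ainf|exists u].
  move=> le; have := eP (tau - u) (MB Mt Mu); rewrite raddfB /= subr_gt0 => /(_ lt).
  by rewrite leNgt => /negP; apply; rewrite ltrBlDr;
    apply: lt_le_trans tlt _; rewrite addrC lerD2l.
exists tau => // z; split=> [zL|[a [b ->]]]; last first.
  have : M (a%:~R * tau - (- b)%:~R) by apply: MB => //; exact: MZ.
  by rewrite /M mulrC rmorphN /= opprK.
pose u := z / w; have Mu : M u by rewrite /M divfK.
pose a := Num.floor (complex.Im u / complex.Im tau).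
have Mv : M (u - a%:~R * tau) by apply: MB => //; exact: MZ.
have vi : complex.Im (u - a%:~R * tau) = complex.Im u - a%:~R * complex.Im tau.
  by rewrite raddfB /= intr_complexE ImZ.
have /andP[f0 f1] := floor_frac_itv (complex.Im u / complex.Im tau).
have vi0 : complex.Im (u - a%:~R * tau) = 0.
  have viE : complex.Im (u - a%:~R * tau) =
      (complex.Im u / complex.Im tau - a%:~R) * complex.Im tau.
    by rewrite vi mulrBl divfK // gt_eqF.
  apply/eqP; rewrite eq_le; apply/andP; split; last by rewrite viE mulr_ge0 // ltW.
  rewrite leNgt; apply/negP => /(tau_min _ Mv).
  by rewrite viE leNgt gtr_pMl // f1.
have [b bE] := M_real Mv vi0.
exists a, b; rewrite -bE addrC subrK /u mulrC divfK //.
Qed.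

End Primitive.
End LatticeBasis.

(** * Multiplication maps between complex tori *)

Section MultiplicationMaps.
Variable R : realType.
Variables (E' E : ellCurve R) (alpha : CC R).
Hypothesis alpha_neq0 : alpha != 0.
Hypothesis alpha_lattice : forall z, z \in lattice E' -> alpha * z \in lattice E.

Definition mulmap (p : pts E') : pts E := pr E (alpha * Defs.lift p).

Lemma mulmapE z : mulmap (pr E' z) = pr E (alpha * z).
Proof. by apply/eqP; rewrite prE -mulrBr; exact/alpha_lattice/lift_pr. Qed.

Lemma mulmap_isogeny : isogeny mulmap.
Proof.
split.
- by move=> p q; rewrite -(Defs.liftK p) -(Defs.liftK q) -prB !mulmapE mulrBr prB.
- move=> z0; exists (fun z => alpha * z); split; last by near=> z; rewrite mulmapE.
  by near=> z; apply: derivableM; [exact: derivable_cst|exact: derivable_id].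
(* The witness is mapped to the class of eps / 2, which is too short to be a nonzero lattice
   element. *)
- have [eps eps0 H] := lattice_discrete E.
  exists (pr E' (eps / 2 / alpha)); rewrite mulmapE mulrC divfK // pr_eq0.
  have e2 : 0 < eps / 2 by rewrite divr_gt0.
  apply/negP => /H; rewrite gtr0_norm // ltr_pdivrMr // ltr_pMr // ltr1n => /(_ isT) e20.
  by move: e2; rewrite e20 ltxx.
Unshelve. all: by end_near.
Qed.

End MultiplicationMaps.

Section MultiplicationIsos.
Variable R : realType.
Variables (E' E : ellCurve R) (alpha : CC R).
Hypothesis alpha_neq0 : alpha != 0.
Hypothesis alpha_lattice : forall z, alpha * z \in lattice E <-> z \in lattice E'.

Lemma mulmap_iso : ell_iso (@mulmap R E' E alpha).
Proof.
have a1 z : z \in lattice E' -> alpha * z \in lattice E by move/alpha_lattice.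
have a2 z : z \in lattice E -> alpha^-1 * z \in lattice E'.
  by move=> zL; apply/alpha_lattice; rewrite mulVKf.
have b0 : alpha^-1 != 0 by rewrite invr_eq0.
split; first exact: mulmap_isogeny.
exists (@mulmap R E E' alpha^-1); split; first exact: mulmap_isogeny.
- by move=> p; rewrite -(Defs.liftK p) !mulmapE // mulKf.
- by move=> p; rewrite -(Defs.liftK p) !mulmapE // mulVKf.
Qed.

End MultiplicationIsos.

(** * Framings: solid tori in terms of two complex numbers *)

Section Framings.
Variable R : realType.
Implicit Types (T : solidTorus R) (w tau z : CC R) (t : R).

(** Equivalently, multiplication by w identifies (E_tau, C_tau) with T, orientation included. *)
Definition framed T w tau : Prop :=
  [/\ w != 0, 0 < complex.Im tau, forall t, circ T t = pr (curve T) (t%:C * w)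
    & forall z, z \in lattice (curve T) <->
                exists a b : int, z = w * (a%:~R * tau + b%:~R)].

Lemma Im_lattice_elt (a b : int) tau :
  complex.Im (a%:~R * tau + b%:~R) = a%:~R * complex.Im tau.
Proof. by rewrite raddfD /= !intr_complexE ImZ /= addr0. Qed.

Lemma framed_exists T : exists w tau, framed T w tau.
Proof.
have [w circE] := circ_lift T.
have wP t : t%:C * w \in lattice (curve T) <-> t \is a Num.int.
  by rewrite -pr_eq0 -circE; split=> [/eqP/circ_ker|/circ_ker/eqP].
have w0 : w != 0.
  apply/eqP => w0; have /intrP[k /eqP] : (2^-1 : R) \is a Num.int.
    by apply/wP; rewrite w0 mulr0 rpred0.
  rewrite -(inj_eq (mulfI (_ : 2 != 0 :> R))) ?pnatr_eq0 // divff ?pnatr_eq0 //.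
  rewrite -[1]/(1%:~R) -[2]/(2%:~R) -rmorphM eqr_int; lia.
have [tau ti tauP] := primitive_basis w0 wP.
by exists w, tau.
Qed.

Lemma framed_std (z : uhp R) : framed (std_torus z) 1 (val z).
Proof.
split; first exact: oner_neq0.
- exact: (valP z).
- by move=> t; rewrite mulr1.
- move=> u; split=> [/asboolP[a [b ->]]|[a [b ->]]]; first by exists a, b; rewrite mul1r.
  by apply/asboolP; exists a, b; rewrite mul1r.
Qed.

Lemma framed_div_circle T w tau n p : framed T w tau -> (0 < n)%N ->
  div_circle n p <-> exists j : int, p = pr (curve T) (w * (j%:~R / n%:R)).
Proof.
move=> [w0 ti cE LE] n0; have nR : n%:R != 0 :> R by rewrite pnatr_eq0 -lt0n.
have circMn t : circ T t *+ n = circ T (t *+ n) by rewrite (zmod_morphMn (@circ_morph _ T)).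
have jE (j : int) : w * (j%:~R / n%:R) = (j%:~R / n%:R : R)%:C * w.
  by rewrite mulrC intr_complexE rmorphM fmorphV /= rmorph_nat.
split=> [[[t _ <-]]|[j ->]].
  rewrite circMn => /circ_ker/intrP[j jE']; exists j.
  by rewrite jE -jE' -(mulr_natr t) mulfK ?cE.
rewrite jE -cE; split; first by exists (j%:~R / n%:R).
by rewrite circMn; apply/circ_ker; rewrite -(mulr_natr (_ / _)) divfK // intr_int.
Qed.

(** The lattice w (Z tau + Z / n) equals (w / n) (Z n tau + Z): dividing by C[n] multiplies tau by
    n. *)
Lemma framed_quot T w tau n : (0 < n)%N -> framed T w tau ->
  framed (quot_torus T n) (w / n%:R) (n%:R * tau).
Proof.
move=> n0 fr; have [w0 ti cE LE] := fr.
have nC : n%:R != 0 :> CC R by rewrite pnatr_eq0 -lt0n.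
have kE : maxn n 1 = n by apply/maxn_idPl.
split; first by rewrite mulf_neq0 ?invr_eq0.
- by rewrite -(rmorph_nat (real_complex R)) ImZ mulr_gt0 // ltr0n.
- move=> t; rewrite /= /quot_circ cE quot_projE kE; congr pr.
  by rewrite rmorphM fmorphV /= rmorph_nat mulrAC mulrA.
- move=> z; split=> [/asboolP|[a [b ->]]].
    rewrite kE => /(framed_div_circle _ fr n0)[j /eqP]; rewrite prE => /LE[a [b]].
    move=> zE; exists a, (b * n%:Z + j).
    rewrite -[z](subrK (w * (j%:~R / n%:R))) zE rmorphD rmorphM /=; field; exact: nC.
  apply/asboolP; rewrite kE; apply/(framed_div_circle _ fr n0); exists b.
  apply/eqP; rewrite prE; apply/LE; exists a, 0; field; exact: nC.
Qed.

(** All real multiples of w - w' lie in the lattice, including arbitrarily short ones, so w = w'.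
    Then tau' = a tau + b and tau = c tau' + d with a, c > 0 and c a = 1. *)
Lemma framed_unique T w tau w' tau' : framed T w tau -> framed T w' tau' ->
  exists k : int, tau' = tau + k%:~R.
Proof.
move=> [w0 ti cE LE] [w'0 t'i cE' LE'].
have ww' : w = w'.
  have [eps eps0 H] := lattice_discrete (curve T).
  have [k /(_ k (leqnn k)) kP] := exists_lt_mul_exp2 (w - w') eps0.
  have k0 : (2 ^+ k : CC R) != 0 by rewrite expf_neq0.
  have := H ((2 ^+ k)^-1 * (w - w')); rewrite -[_ \in _](pr_eq0 (curve T)).
  have -> : (2 ^+ k)^-1 = ((2 ^+ k)^-1 : R)%:C :> CC R.
    by rewrite fmorphV rmorphXn /= (rmorph_nat (real_complex R)).
  rewrite mulrBr prB -cE -cE' subrr => /(_ (eqxx _)).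
  rewrite -mulrBr normrM fmorphV rmorphXn /= (rmorph_nat (real_complex R)).
  rewrite normfV normrX (ger0_norm (ler0n _ 2)) mulrC ltr_pdivrMr ?exprn_gt0 //.
  move=> /(_ kP)/eqP.
  by rewrite mulf_eq0 invr_eq0 (negPf k0) /= subr_eq0 => /eqP.
subst w'.
have [a [b]] : exists a b : int, w * tau' = w * (a%:~R * tau + b%:~R).
  by apply/LE/LE'; exists 1, 0; rewrite mul1r addr0.
move/(mulfI w0) => t'E.
have [c [d]] : exists a b : int, w * tau = w * (a%:~R * tau' + b%:~R).
  by apply/LE'/LE; exists 1, 0; rewrite mul1r addr0.
move/(mulfI w0) => tE.
have i1 : complex.Im tau' = a%:~R * complex.Im tau.
  by rewrite t'E Im_lattice_elt.
have i2 : complex.Im tau = c%:~R * complex.Im tau'.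
  by rewrite tE Im_lattice_elt.
have a0 : 0 < a by move: t'i; rewrite i1 pmulr_lgt0 // ltr0z.
have c0 : 0 < c by move: ti; rewrite i2 pmulr_lgt0 // ltr0z.
have : (c * a)%:~R * complex.Im tau = 1%:~R * complex.Im tau.
  by rewrite rmorphM /= -mulrA -i1 -i2 mul1r.
move/(mulIf (lt0r_neq0 ti))/eqP; rewrite eqr_int => /eqP ca.
have a1 : a = 1 by nia.
by exists b; rewrite t'E a1 mul1r.
Qed.

Lemma framed_iso T T' w w' tau : framed T w tau -> framed T' w' tau -> torus_iso T T'.
Proof.
move=> [w0 ti cE LE] [w'0 _ cE' LE'].
have a0 : w' / w != 0 by rewrite mulf_neq0 ?invr_eq0.
have aL z : w' / w * z \in lattice (curve T') <-> z \in lattice (curve T).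
  split=> [/LE'[a [b E]]|/LE[a [b ->]]]; last by apply/LE'; exists a, b; rewrite mulrA divfK.
  by apply/LE; exists a, b; apply: (mulfI a0); rewrite E mulrA divfK.
have fc t : mulmap (curve T') (w' / w) (circ T t) = circ T' t.
  by rewrite cE mulmapE ?cE' 1?mulrCA ?divfK // => z /aL.
exists (@mulmap _ (curve T) (curve T') (w' / w)); split; first exact: mulmap_iso.
- apply/seteqP; split=> [_ [_ [t _ <-] <-]|_ [t _ <-]]; first by exists t; rewrite ?fc.
  by exists (circ T t); [exists t|exact: fc].
- by exists id => // t; exact: fc.
Qed.

(** The isomorphism is multiplication by some alpha, and all rests on alpha w = w': matching circles
    restrict the ratio [c] to 1 or -1, and orientation decides. *)
Lemma iso_framed T T' w' tau : torus_iso T T' -> framed T' w' tau ->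
  exists w, framed T w tau.
Proof.
move=> [f [[fiso [g [_ fK _]]] _ [r rmono rE]]] [w'0 ti cE' LE'].
have [w [tau0 [w0 _ cE LE]]] := framed_exists T.
have [alpha a0 fE] := isogeny_lift fiso.
have fL z : z \in lattice (curve T) <-> alpha * z \in lattice (curve T').
  have [fB _ _] := fiso; rewrite -!pr_eq0 -fE; split=> [/eqP->|].
    by rewrite (zmod_morph0 fB).
  by rewrite -[X in _ == X -> _](zmod_morph0 fB) (can_eq fK).
pose c := alpha * w / w'.
have cP t : exists a b : int, t%:C * c - (r t)%:C = a%:~R * tau + b%:~R.
  have /eqP := rE t; rewrite cE fE cE' prE => /LE'[a [b E]]; exists a, b.
  by apply: (mulfI w'0); rewrite -E /c; field; exact: w'0.
(* Otherwise some real t gives the left side of [cP] the imaginary part Im tau / 2, not an integral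
   multiple of Im tau. *)
have cIm : complex.Im c = 0.
  apply/eqP/negPn/negP => c0.
  have [a [b /(congr1 (@complex.Im R))]] := cP (complex.Im tau / 2 / complex.Im c).
  rewrite Im_lattice_elt raddfB /= ImZ subr0 divfK // mulrC.
  move/(mulIf (lt0r_neq0 ti))/eqP.
  rewrite -(inj_eq (mulfI (_ : 2 != 0 :> R))) ?pnatr_eq0 // divff ?pnatr_eq0 //.
  rewrite -[1]/(1%:~R) -[2]/(2%:~R) -rmorphM eqr_int; lia.
have := real_complexP cIm; set u := complex.Re c => cu.
have uP t : exists b : int, t * u - r t = b%:~R.
  have [a [b]] := cP t; rewrite cu -rmorphM -rmorphB => E.
  have /(congr1 (@complex.Im R)) := E; rewrite Im_lattice_elt /= => /esym/eqP.
  rewrite mulf_eq0 (gt_eqF ti) orbF => /eqP a00; exists b.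
  by move: E; rewrite !intr_complexE a00 rmorph0 mul0r add0r => -[].
(* Injectivity of f on the circle makes both u and its inverse integers. *)
have uZ t : t * u \is a Num.int <-> t \is a Num.int.
  have [fB _ _] := fiso; have fcirc : circ T' (t * u) = f (circ T t).
    by rewrite cE cE' fE rmorphM /= -cu /c; congr pr; field; exact: w'0.
  split=> H; last by apply/(circ_ker T'); rewrite fcirc (proj2 (circ_ker T t) H) zmod_morph0.
  apply/(circ_ker T); apply: (can_inj fK); rewrite -fcirc (zmod_morph0 fB).
  exact/(circ_ker T').
have uc1 : u = 1.
  have /intrP[k kE] : u \is a Num.int by rewrite -[u]mul1r; apply/uZ.
  have u0 : u != 0.
    by apply: contraNneq a0 => u0; move: cu; rewrite u0 => /eqP;
      rewrite /c !mulf_eq0 invr_eq0 (negPf w0) (negPf w'0) !orbF.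
  have /intrP[k' k'E] : u^-1 \is a Num.int by apply/uZ; rewrite mulVf // rpred1.
  have kk' : k * k' = 1.
    by apply/eqP; rewrite -(eqr_int R) rmorphM /= -kE -k'E divff.
  have [k1|k1] : k = 1 \/ k = -1.
    by have /(congr1 absz)/eqP := kk'; rewrite abszM muln_eq1 => /andP[/eqP k1 _]; lia.
    by rewrite kE k1.
  (* For u = -1, t + r t is integer valued and strictly increasing in t. It grows by at least 1 at
     each of d + 1 steps from 0 to 1, but by at most d in total. *)
  exfalso.
  have sP t : exists b : int, t + r t = b%:~R.
    have [b bE] := uP t; exists (- b); rewrite rmorphN /= -bE kE k1 rmorphN mulrN1.
    by rewrite opprB opprK addrC.
  have [s sE] := choice sP.
  have smono t1 t2 : t1 < t2 -> s t1 + 1 <= s t2.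
    move=> lt; rewrite lezD1 -(ltr_int R) -!sE ltrD // rmono //.
  pose d := absz (s 1 - s 0)%R.
  have step i : s 0 + i%:Z <= s (i%:R / d.+1%:R).
    elim: i => [|i IH]; first by rewrite mul0r addr0.
    have lt : i%:R / d.+1%:R < i.+1%:R / d.+1%:R :> R by rewrite ltr_pM2r ?ltr_nat // invr_gt0.
    have := smono _ _ lt; lia.
  have : s 0 + d.+1%:Z <= s 1 by have := step d.+1; rewrite divff ?pnatr_eq0.
  rewrite /d; lia.
have alw : alpha * w = w'.
  by rewrite -[LHS](divfK w'0) -/c cu uc1 mul1r.
exists w; split=> // z; rewrite fL LE' -alw.
split=> -[a [b E]]; exists a, b; last by rewrite E mulrA.
by apply: (mulfI a0); rewrite E mulrA.
Qed.

End Framings.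

(** * From matrices to n+e-related solid tori *)

Section Related.
Variable R : realType.
Implicit Types (T : solidTorus R) (w tau z : CC R) (t : R).

Section FramedMultiplication.
Variables (T' T : solidTorus R) (w' tau' w tau alpha : CC R) (p q r s : int).
Hypotheses (fr' : framed T' w' tau') (fr : framed T w tau).
Hypothesis row1 : alpha * (w' * tau') = w * (p%:~R * tau + q%:~R).
Hypothesis row2 : alpha * w' = w * (r%:~R * tau + s%:~R).

Lemma framed_mul_lattice z :
  z \in lattice (curve T') -> alpha * z \in lattice (curve T).
Proof.
have [_ _ _ LE'] := fr'; have [_ _ _ LE] := fr.
move=> /LE'[a [b ->]]; apply/LE; exists (a * p + b * r), (a * q + b * s).
transitivity (a%:~R * (alpha * (w' * tau')) + b%:~R * (alpha * w')); first by ring.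
by rewrite row1 row2 !rmorphD !rmorphM /=; ring.
Qed.

(** p, q, r, s form the matrix of alpha in the bases given by the framings; with determinant 1 it is
    invertible over Z. *)
Lemma framed_mul_lattice_iff z : p * s - q * r = 1 ->
  alpha * z \in lattice (curve T) <-> z \in lattice (curve T').
Proof.
move=> det; split; last exact: framed_mul_lattice.
have [w'0 _ _ LE'] := fr'; have [w0 ti _ LE] := fr.
have detC : p%:~R * s%:~R - q%:~R * r%:~R = 1 :> CC R.
  by have /(congr1 (intmul (1 : CC R))) := det; rewrite rmorphB !rmorphM.
have a0 : alpha != 0.
  apply/eqP => a0; have E0 : w * tau * (p%:~R * s%:~R - q%:~R * r%:~R) = 0.
    transitivity (s%:~R * (alpha * (w' * tau')) - q%:~R * (alpha * w')).
      by rewrite row1 row2; ring.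
    by rewrite a0; ring.
  have tau0 : tau != 0 by apply: contraTneq ti => ->; rewrite ltxx.
  by move/eqP: E0; rewrite detC mulr1 mulf_eq0 (negPf w0) (negPf tau0).
move=> /LE[a [b E]]; apply/LE'; exists (a * s - b * r), (b * p - a * q).
apply: (mulfI a0); rewrite E.
transitivity
  ((a * s - b * r)%:~R * (alpha * (w' * tau')) + (b * p - a * q)%:~R * (alpha * w')); last by ring.
rewrite row1 row2 !rmorphB !rmorphM /=.
transitivity (w * (a%:~R * tau + b%:~R) * (p%:~R * s%:~R - q%:~R * r%:~R)); last by ring.
by rewrite detC mulr1.
Qed.

(** As n divides r, alpha w' / n is congruent to s w / n modulo the lattice: on n-division points of
    the circles the map is multiplication by s. *)
Lemma framed_mul_div_circle n c : (0 < n)%N -> r = n%:Z * c ->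
  mulmap (curve T) alpha @` @div_circle R T' n `<=` @div_circle R T n.
Proof.
move=> n0 rE _ [_ /(framed_div_circle _ fr' n0)[j ->] <-].
apply/(framed_div_circle _ fr n0); exists (s * j).
have [_ _ _ LE] := fr.
rewrite mulmapE; last exact: framed_mul_lattice.
apply/eqP; rewrite prE; apply/LE; exists (j * c), 0.
have nC : n%:R != 0 :> CC R by rewrite pnatr_eq0 -lt0n.
have -> : alpha * (w' * (j%:~R / n%:R)) = alpha * w' * (j%:~R / n%:R) by ring.
by rewrite row2 rE !rmorphM /=; field.
Qed.

(** Multiplication by s is onto C[n] when s is a unit modulo n; u is the inverse. *)
Lemma framed_mul_div_circle_eq n c : (0 < n)%N -> r = n%:Z * c -> coprimez s n%:Z ->
  mulmap (curve T) alpha @` @div_circle R T' n = @div_circle R T n.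
Proof.
move=> n0 rE /coprimezP[[u v] /= uv]; apply/seteqP; split.
  exact: framed_mul_div_circle rE.
move=> _ /(framed_div_circle _ fr n0)[j ->].
exists (pr (curve T') (w' * ((u * j)%:~R / n%:R))).
  by apply/(framed_div_circle _ fr' n0); exists (u * j).
have [_ _ _ LE] := fr.
rewrite mulmapE; last exact: framed_mul_lattice.
apply/eqP; rewrite prE; apply/LE; exists (u * j * c), (- (v * j)).
have nC : n%:R != 0 :> CC R by rewrite pnatr_eq0 -lt0n.
have -> : alpha * (w' * ((u * j)%:~R / n%:R)) = alpha * w' * ((u * j)%:~R / n%:R) by ring.
have uvC : u%:~R * s%:~R + v%:~R * n%:R = 1 :> CC R.
  by have /(congr1 (intmul (1 : CC R))) := uv; rewrite rmorphD !rmorphM.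
have jC : j%:~R = (u%:~R * s%:~R + v%:~R * n%:R) * j%:~R :> CC R by rewrite uvC mul1r.
rewrite row2 rE rmorphN !rmorphM /= [X in _ - w * (X / _)]jC.
by field.
Qed.

End FramedMultiplication.

(** f and g are multiplication by alpha, and k by alpha / e because [quot_back] multiplies by e. In
    the bases of the framings f has rows (a e, b) and (c m, d e), of determinant e. Passing to the
    quotient by e-division points in the source (for g) or the target (for k) brings the determinant
    to 1 and the lower left entry to c m / e. *)
Lemma framed_related m e (a b c d : int) T T' w tau w' tau' :
  (0 < m)%N -> exact_div m e -> a * d * e%:Z - b * c * (m %/ e)%N%:Z = 1 ->
  framed T w tau -> framed T' w' tau' ->
  c%:~R * m%:R * tau + d%:~R * e%:R != 0 ->
  tau' * (c%:~R * m%:R * tau + d%:~R * e%:R) = a%:~R * e%:R * tau + b%:~R ->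
  related m e T T'.
Proof.
move=> m0 [em ecop] det fr fr' den0 tau'E.
have e0 : (0 < e)%N := dvdn_gt0 m0 em.
have me0 : (0 < m %/ e)%N by rewrite divn_gt0 // dvdn_leq.
have [w0 _ _ _] := fr; have [w'0 _ _ _] := fr'.
have eC : e%:R != 0 :> CC R by rewrite pnatr_eq0 -lt0n.
have mE : m%:R = (m %/ e)%N%:R * e%:R :> CC R by rewrite -natrM divnK.
set D := c%:~R * m%:R * tau + d%:~R * e%:R in den0 tau'E.
pose alpha := w / w' * D.
have a0 : alpha != 0 by rewrite !mulf_neq0 ?invr_eq0.
have r2 : alpha * w' = w * D by rewrite /alpha mulrAC divfK.
have r1 : alpha * (w' * tau') = w * (a%:~R * e%:R * tau + b%:~R).
  by rewrite mulrA r2 -mulrA [D * _]mulrC tau'E.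
have frT := framed_quot e0 fr; have frT' := framed_quot e0 fr'.
have f1 : alpha * (w' * tau') = w * ((a * e%:Z)%:~R * tau + b%:~R).
  by rewrite r1 rmorphM.
have f2 : alpha * w' = w * ((m%:Z * c)%:~R * tau + (d * e%:Z)%:~R).
  by rewrite r2 /D !rmorphM /= [m%:R * _]mulrC.
have g1 : alpha * (w' / e%:R * (e%:R * tau')) = w * ((a * e%:Z)%:~R * tau + b%:~R).
  by rewrite -f1; field; exact: eC.
have g2 : alpha * (w' / e%:R) = w * (((m %/ e)%N%:Z * c)%:~R * tau + d%:~R).
  by rewrite mulrA r2 /D mE !rmorphM /=; field; exact: eC.
have k1 : alpha / e%:R * (w' * tau') = w / e%:R * (a%:~R * (e%:R * tau) + b%:~R).
  by rewrite mulrAC r1; field; exact: eC.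
have k2 : alpha / e%:R * w' =
    w / e%:R * (((m %/ e)%N%:Z * c)%:~R * (e%:R * tau) + (d * e%:Z)%:~R).
  by rewrite mulrAC r2 /D mE !rmorphM /=; field; exact: eC.
have aeC : alpha / e%:R != 0 by rewrite mulf_neq0 ?invr_eq0.
have fL := framed_mul_lattice fr' fr f1 f2.
have gdet : a * e%:Z * d - b * ((m %/ e)%N%:Z * c) = 1 by rewrite -[RHS]det; ring.
have kdet : a * (d * e%:Z) - b * ((m %/ e)%N%:Z * c) = 1 by rewrite -[RHS]det; ring.
have gL z := framed_mul_lattice_iff frT' fr g1 g2 z gdet.
have kL z := framed_mul_lattice_iff fr' frT k1 k2 z kdet.
exists (@mulmap R (curve T') (curve T) alpha),
  (@mulmap R (curve (quot_torus T' e)) (curve T) alpha),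
  (@mulmap R (curve T') (curve (quot_torus T e)) (alpha / e%:R)); split.
- split; first exact: mulmap_isogeny.
  exact (framed_mul_div_circle fr' fr f1 f2 m0 erefl).
- apply: funext => p; rewrite -(Defs.liftK p) /= quot_projE !mulmapE // => z.
  by move/gL.
- apply: funext => p; rewrite -(Defs.liftK p) /= !mulmapE //; last by move=> z /kL.
  rewrite -quot_projE quot_backE (maxn_idPl _) // -prMn.
  by congr pr; rewrite -(mulr_natr (_ / _ * _)); field; exact: eC.
- split; first exact: mulmap_iso.
  apply: (framed_mul_div_circle_eq frT' fr g1 g2 me0 erefl).
  by apply/coprimezP; exists (a * e%:Z, - (b * c)); rewrite /= -[RHS]det; ring.
- split; first exact: mulmap_iso.
  apply: (framed_mul_div_circle_eq fr' frT k1 k2 me0 erefl).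
  by apply/coprimezP; exists (a, - (b * c)); rewrite /= -[RHS]det; ring.
Qed.

Lemma framed_bar_equiv m h (S : set nat) (A : 'M[R]_2) T T' w w' (z z' : CC R) :
  (0 < m)%N -> (0 < h)%N -> Ex_subgroup m S -> Gamma0_bar (m * h) h S A ->
  framed T w z -> framed T' w' z' -> z' = moebius A z ->
  bar_equiv (m * h) h S T T'.
Proof.
move=> m0 h0 [Sex _ _] /(Gamma0_barE m h0)[e Se ALe] fr fr' z'E.
have zi : 0 < complex.Im z by case: fr.
have ex := Sex _ Se; have [em _] := ex.
have den0 := moebius_den_neq0 (AL_det m0 h0 em ALe) zi.
have [a [b [c [d [k [k0 det AE]]]]]] := ALe.
have hC : h%:R != 0 :> CC R by rewrite pnatr_eq0 -lt0n.
have kC : k%:C != 0 :> CC R by rewrite fmorph_eq0.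
exists e => //; rewrite mulnK //.
(* On h z the group element acts with rows (a e, b) and (c m, d e), whose entries are integers. *)
have den1 : c%:~R * m%:R * (h%:R * z) + d%:~R * e%:R != 0.
  apply: contraNneq den0 => E; apply/eqP; rewrite AE !mxE /= !rmorphM /=.
  rewrite !(rmorph_int (real_complex R)) !(rmorph_nat (real_complex R)).
  transitivity (k%:C * (c%:~R * m%:R * (h%:R * z) + d%:~R * e%:R)); first by ring.
  by rewrite E mulr0.
apply: (framed_related m0 ex det (framed_quot h0 fr) (framed_quot h0 fr') den1).
rewrite z'E AE moebiusZ // /moebius !mxE /= !rmorphM fmorphV /=.
rewrite !(rmorph_int (real_complex R)) !(rmorph_nat (real_complex R)).
have -> : c%:~R * (m%:R * h%:R) * z = c%:~R * m%:R * (h%:R * z) by ring.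
by field; rewrite den1.
Qed.

End Related.

(** * Classes of equivalence relations and induced bijections *)

Section Classes.
Variables (X : Type) (r : X -> X -> Prop).
Hypotheses (r_refl : forall x, r x x) (r_sym : forall x x', r x x' -> r x' x).
Hypothesis r_trans : forall x x' x'', r x x' -> r x' x'' -> r x x''.

Lemma eq_class_of x x' : class_of r x = class_of r x' <-> r x x'.
Proof.
split=> [[E]|rx].
  by apply: r_sym; have : [set y | r x' y] x by rewrite -E; exact: r_refl.
have E : [set y | r x y] = [set y | r x' y].
  by apply/seteqP; split=> y /=; [apply: r_trans (r_sym rx)|apply: r_trans rx].
exact: eq_exist.
Qed.

Lemma classes_ofP (c : classes_of r) : exists x, c = class_of r x.
Proof. by case: c => A [x AE]; exists x; exact: eq_exist. Qed.

End Classes.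

(** F goes through chosen representatives. As f preserves and reflects the relations, F is
    independent of the choice and injective; choosing preimages up to s gives the inverse. *)
Lemma classes_of_bij (X Y : Type) (r : X -> X -> Prop) (s : Y -> Y -> Prop) (f : X -> Y) :
  (forall x, r x x) -> (forall x x', r x x' -> r x' x) ->
  (forall x x' x'', r x x' -> r x' x'' -> r x x'') ->
  (forall y, s y y) -> (forall y y', s y y' -> s y' y) ->
  (forall y y' y'', s y y' -> s y' y'' -> s y y'') ->
  (forall x x', s (f x) (f x') <-> r x x') -> (forall y, exists x, s y (f x)) ->
  exists F : classes_of r -> classes_of s,
    bijective F /\ forall x, F (class_of r x) = class_of s (f x).
Proof.
move=> r1 r2 r3 s1 s2 s3 fE fS.
have [rep repE] := choice (@classes_ofP _ r).
have [rep' rep'E] := choice (@classes_ofP _ s).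
have [g gE] := choice fS.
exists (fun c => class_of s (f (rep c))).
have FE x : class_of s (f (rep (class_of r x))) = class_of s (f x).
  by apply/eq_class_of/fE/(eq_class_of r1 r2 r3); rewrite -?repE.
split=> //; exists (fun C => class_of r (g (rep' C))) => [c|C].
  rewrite [RHS]repE; apply/(eq_class_of r1 r2 r3)/fE; apply: (s2).
  apply: (s3) (gE _); apply/(eq_class_of s1 s2 s3); exact: rep'E.
by rewrite FE [RHS]rep'E; apply/(eq_class_of s1 s2 s3)/s2.
Qed.

(** * n||h+S-equivalence as an orbit relation *)

Section DbarEquivalence.
Variables (R : realType) (m h : nat) (S : set nat) (lam : 'M[R]_2 -> int).
Hypotheses (m_gt0 : (0 < m)%N) (h_gt0 : (0 < h)%N).
Hypothesis S_subgroup : Ex_subgroup m S.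
Hypothesis lam_lambda : is_lambda (m * h) h S lam.
Implicit Types (z : uhp R) (T : solidTorus R).

Let n := (m * h)%N.
Let G := Gamma0_dbar n h S lam.

(** Integer translations lie in Gamma_0(nh), where lambda vanishes; they absorb the ambiguity of tau
    in a framing. *)
Lemma orbit_rel_translation z z' (k : int) :
  val z' = val z + k%:~R -> orbit_rel G z z'.
Proof.
move=> z'E; exists (mx2 1 k%:~R 0 1).
  by apply: Gamma0_dbar_sub => //; exact: Gamma0_translation.
by rewrite z'E /moebius !mxE /= !rmorph1 rmorph0 mul1r mul0r add0r divr1;
  rewrite (rmorph_int (real_complex R)).
Qed.

Lemma orbit_rel_refl z : orbit_rel G z z.
Proof. by apply: (@orbit_rel_translation _ _ 0); rewrite addr0. Qed.

Lemma orbit_rel_sym z z' : orbit_rel G z z' -> orbit_rel G z' z.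
Proof.
move=> [A GA z'E]; have [B GB BA] := Gamma0_dbar_inv m_gt0 h_gt0 S_subgroup lam_lambda GA.
exists B => //; rewrite z'E -moebiusM ?BA.
- by rewrite /moebius !mxE /= !rmorph1 !rmorph0 mul1r mul0r addr0 add0r divr1.
- by case: GA => /(Gamma0_bar_det m_gt0 h_gt0 S_subgroup).
- by case: GB => /(Gamma0_bar_det m_gt0 h_gt0 S_subgroup).
- exact: (valP z).
Qed.

Lemma orbit_rel_trans z z' z'' :
  orbit_rel G z z' -> orbit_rel G z' z'' -> orbit_rel G z z''.
Proof.
move=> [A GA z'E] [B GB z''E]; exists (B *m A); first exact: Gamma0_dbar_mul.
rewrite z''E z'E moebiusM //; last exact: (valP z).
- by case: GA => /(Gamma0_bar_det m_gt0 h_gt0 S_subgroup).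
- by case: GB => /(Gamma0_bar_det m_gt0 h_gt0 S_subgroup).
Qed.

(** Framings replace isomorphisms with standard tori, and a word is replaced by its product A, whose
    [lam] is the sum over the letters modulo h. Conversely A supplies both the word and the
    isogenies of [bar_equiv]. *)
Lemma dbar_equivP T T' : dbar_equiv n h S lam T T' <->
  exists z z' : uhp R, [/\ exists w, framed T w (val z),
    exists w', framed T' w' (val z') & orbit_rel G z z'].
Proof.
split=> [[_ [z [z' [g0 [gs [[iso iso'] Gg0 gsP z'E sum0]]]]]]|].
  exists z, z'; split; [exact: iso_framed (framed_std z)|exact: iso_framed (framed_std z')|].
  exists (foldr (fun g => mulmx g) g0 gs); last first.
    by rewrite (@moebius_word R m h S) //; exact: (valP z).
  split; first exact: word_bar.
  by rewrite (lam_word m_gt0 h_gt0 S_subgroup lam_lambda Gg0 gsP).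
move=> [z [z' [[w fr] [w' fr'] [A [GA A0] z'E]]]].
split; first exact: framed_bar_equiv fr fr' z'E.
have [gs [g0 [Gg0 gsP AE]]] := Gamma0_bar_word m_gt0 h_gt0 S_subgroup GA.
exists z, z', g0, gs; split=> //.
- by split; [exact: framed_iso fr (framed_std z)|exact: framed_iso fr' (framed_std z')].
- by rewrite z'E AE (moebius_word m_gt0 h_gt0 S_subgroup) //; exact: (valP z).
- by rewrite -(lam_word m_gt0 h_gt0 S_subgroup lam_lambda Gg0 gsP) -AE.
Qed.

Lemma exists_framing T : exists (z : uhp R) w, framed T w (val z).
Proof.
have [w [tau fr]] := framed_exists T.
by have [_ ti _ _] := fr; exists (exist _ tau ti), w.
Qed.

Lemma framed_orbit_rel T w w' z z' :
  framed T w (val z) -> framed T w' (val z') -> orbit_rel G z z'.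
Proof. by move=> fr /(framed_unique fr)[k]; exact: orbit_rel_translation. Qed.

Lemma dbar_equiv_refl T : dbar_equiv n h S lam T T.
Proof.
have [z [w fr]] := exists_framing T; apply/dbar_equivP; exists z, z.
by split; [exists w|exists w|exact: orbit_rel_refl].
Qed.

Lemma dbar_equiv_sym T T' : dbar_equiv n h S lam T T' -> dbar_equiv n h S lam T' T.
Proof.
move=> /dbar_equivP[z [z' [fr fr' zz']]]; apply/dbar_equivP; exists z', z.
by split=> //; exact: orbit_rel_sym.
Qed.

(** The two framings of the middle torus differ by an integer translation, which links the two orbit
    relations. *)
Lemma dbar_equiv_trans T T' T'' : dbar_equiv n h S lam T T' ->
  dbar_equiv n h S lam T' T'' -> dbar_equiv n h S lam T T''.
Proof.
move=> /dbar_equivP[z [z' [fr [w' fr'] zz']]].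
move=> /dbar_equivP[y [y' [[w frT'] fr'' yy']]]; apply/dbar_equivP; exists z, y'.
split=> //; apply: orbit_rel_trans zz' _; apply: orbit_rel_trans yy'.
exact: framed_orbit_rel fr' frT'.
Qed.

Lemma dbar_equiv_std z z' :
  dbar_equiv n h S lam (std_torus z) (std_torus z') <-> orbit_rel G z z'.
Proof.
split=> [/dbar_equivP[y [y' [[w fr] [w' fr'] yy']]]|zz'].
  apply: orbit_rel_trans (framed_orbit_rel (framed_std z) fr) _.
  exact: orbit_rel_trans yy' (framed_orbit_rel fr' (framed_std z')).
apply/dbar_equivP; exists z, z'.
by split=> //; exists 1; exact: framed_std.
Qed.

Lemma dbar_equiv_exists_std T : exists z : uhp R, dbar_equiv n h S lam T (std_torus z).
Proof.
have [z [w fr]] := exists_framing T; exists z; apply/dbar_equivP; exists z, z.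
by split; [exists w|exists 1; exact: framed_std|exact: orbit_rel_refl].
Qed.

End DbarEquivalence.

Theorem theorem6p2p3 (R : realType) (N h n : nat) (S : set nat)
    (lam : 'M[R]_2 -> int)
    (N_gt0 : (0 < N)%N)
    (h_sqr : (h ^ 2 %| N)%N) (h_24 : (h %| 24)%N)
    (h_max : forall k : nat, (k ^ 2 %| N)%N -> (k %| 24)%N -> (k <= h)%N)
    (n_def : n = (N %/ h)%N)
    (S_subgroup : Ex_subgroup (n %/ h)%N S)
    (lam_lambda : is_lambda n h S lam) :
  [/\ forall T : solidTorus R, dbar_equiv n h S lam T T,
      forall T T' : solidTorus R,
        dbar_equiv n h S lam T T' -> dbar_equiv n h S lam T' T,
      forall T T' T'' : solidTorus R,
        dbar_equiv n h S lam T T' -> dbar_equiv n h S lam T' T'' ->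
        dbar_equiv n h S lam T T''
    & exists F : classes_of (orbit_rel (Gamma0_dbar n h S lam)) ->
                 classes_of (@dbar_equiv R n h S lam),
        bijective F /\
        forall z : uhp R, F (class_of _ z) = class_of _ (std_torus z)].
Proof.
(* m = N / h^2 = n / h, so S is a subgroup of Ex(m). *)
have [m NE] := dvdnP h_sqr.
have [m_gt0 h_gt0] : (0 < m)%N /\ (0 < h)%N.
  by move: N_gt0; rewrite NE muln_gt0 expn_gt0 orbF => /andP.
have nE : n = (m * h)%N by rewrite n_def NE -mulnn mulnA mulnK.
subst n; rewrite nE in S_subgroup lam_lambda *; rewrite mulnK // in S_subgroup.
split.
- exact: dbar_equiv_refl.
- exact: dbar_equiv_sym.
- exact: dbar_equiv_trans.
- apply: classes_of_bij.
  + exact: orbit_rel_refl.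
  + exact: orbit_rel_sym.
  + exact: orbit_rel_trans.
  + exact: dbar_equiv_refl.
  + exact: dbar_equiv_sym.
  + exact: dbar_equiv_trans.
  + exact: dbar_equiv_std.
  + exact: dbar_equiv_exists_std.
Qed.
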